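(* Let $R$ be an associative ring with identity such that $\mathcal{P}(R)\subseteq\mathcal{SFI}^{\vee}$. Then every (left) $R$-module has a $\mathcal{GP}$-precover.
   Context: All modules are left $R$-modules; $\mathcal{P}(R)$ is the class of projective left $R$-modules. $\mathcal{SFI}$ is the class of strongly FP-injective modules, i.e. modules $E$ with $\mathrm{Ext}^k_R(F,E)=0$ for all $k\ge1$ and all finitely presented modules $F$. $\mathcal{SFI}^{\vee}$ is the class of modules $M$ for which there exist $m\ge0$ and an exact sequence $0\to M\to E^0\to\cdots\to E^m\to0$ with all $E^i\in\mathcal{SFI}$. $\mathcal{GP}$ is the class of Gorenstein projective modules: cycles of acyclic complexes of projective modules that remain exact after applying $\mathrm{Hom}_R(-,P)$ for all $P\in\mathcal{P}(R)$. For a class $\mathcal{X}$, an $\mathcal{X}$-precover of $M$ is a morphism $\varphi:X\to M$ with $X\in\mathcal{X}$ such that every morphism $\varphi':X'\to M$ with $X'\in\mathcal{X}$ factors as $\varphi'=\varphi\circ h$ for some $h:X'\to X$. *)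

(* Defs.v *)
From HB Require Import structures.
From mathcomp Require Import all_boot all_order all_algebra.

Set Implicit Arguments.
Unset Strict Implicit.
Unset Printing Implicit Defensive.

Import GRing.Theory.
Local Open Scope ring_scope.

(* [R : pzRingType] is an associative ring with identity, possibly zero and    *)
(* possibly non-commutative; [lmodType R] is the type of its left modules.     *)

Definition exact_at (R : pzRingType) (A B C : lmodType R)
    (f : {linear A -> B}) (g : {linear B -> C}) : Prop :=
  forall y : B, g y = 0 <-> exists x : A, f x = y.

Definition surjective (A B : Type) (f : A -> B) : Prop :=
  forall y : B, exists x : A, f x = y.

(* Exactness of Hom(C, N) -> Hom(B, N) -> Hom(A, N) at Hom(B, N).              *)
Definition hom_exact_at (R : pzRingType) (A B C : lmodType R)
    (f : {linear A -> B}) (g : {linear B -> C}) (N : lmodType R) : Prop :=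
  forall h : {linear B -> N},
    (forall x : A, h (f x) = 0) <-> exists k : {linear C -> N}, h =1 k \o g.

Definition projective (R : pzRingType) (P : lmodType R) : Prop :=
  forall (A B : lmodType R) (p : {linear A -> B}) (f : {linear P -> B}),
    surjective p -> exists h : {linear P -> A}, f =1 p \o h.

Definition finitely_presented (R : pzRingType) (F : lmodType R) : Prop :=
  exists (m n : nat) (f : {linear 'rV[R]_m -> 'rV[R]_n})
         (g : {linear 'rV[R]_n -> F}),
    exact_at f g /\ surjective g.

Record projective_resolution (R : pzRingType) (F : lmodType R) := ProjRes {
  pr_obj : nat -> lmodType R;
  pr_diff : forall n : nat, {linear pr_obj n.+1 -> pr_obj n};
  pr_aug : {linear pr_obj 0%N -> F};
  pr_projective : forall n : nat, projective (pr_obj n);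
  pr_exact : forall n : nat, exact_at (pr_diff n.+1) (pr_diff n);
  pr_exact0 : exact_at (pr_diff 0%N) pr_aug;
  pr_aug_surj : surjective pr_aug
}.

(* Degree-k cocycles and coboundaries of the cochain complex Hom(Q, E), whose  *)
(* k-th cohomology is Ext^k(F, E).                                             *)
Definition ext_cocycle (R : pzRingType) (F : lmodType R)
    (Q : projective_resolution F) (E : lmodType R) (k : nat)
    (f : {linear pr_obj Q k -> E}) : Prop :=
  forall x : pr_obj Q k.+1, f (pr_diff Q k x) = 0.

Definition ext_coboundary (R : pzRingType) (F : lmodType R)
    (Q : projective_resolution F) (E : lmodType R) (k : nat) :
    {linear pr_obj Q k -> E} -> Prop :=
  match k with
  | 0 => fun f => forall x, f x = 0
  | j.+1 => fun f =>
      exists g : {linear pr_obj Q j -> E}, f =1 g \o pr_diff Q j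
  end.

(* Ext^k(F, E) = 0. Every module has a projective resolution, and the          *)
(* cohomology does not depend on it, so "for all" and "for some" resolution    *)
(* give the same notion.                                                       *)
Definition Ext_zero (R : pzRingType) (k : nat) (F E : lmodType R) : Prop :=
  forall (Q : projective_resolution F) (f : {linear pr_obj Q k -> E}),
    ext_cocycle f -> ext_coboundary f.

Definition strongly_FP_injective (R : pzRingType) (E : lmodType R) : Prop :=
  forall (k : nat) (F : lmodType R),
    (1 <= k)%N -> finitely_presented F -> Ext_zero k F E.

(* The finite sequence 0 -> M -> E^0 -> ... -> E^m -> 0 is continued by zero   *)
(* modules in degrees > m, so that exactness at E^m is the surjectivity of the *)
(* map into E^m.                                                               *)
Definition finite_coresolution (R : pzRingType) (X : lmodType R -> Prop)
    (M : lmodType R) : Prop :=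
  exists (m : nat) (E : nat -> lmodType R) (eta : {linear M -> E 0%N})
         (d : forall i : nat, {linear E i -> E i.+1}),
    [/\ forall i : nat, (i <= m)%N -> X (E i),
        forall i : nat, (m < i)%N -> forall x : E i, x = 0,
        injective eta,
        exact_at eta (d 0%N)
      & forall i : nat, exact_at (d i) (d i.+1)].

Definition SFI_vee (R : pzRingType) : lmodType R -> Prop :=
  finite_coresolution (@strongly_FP_injective R).

(* The differential [d i] goes from degree i + 1 to degree i, so M is          *)
(* isomorphic to a cycle module ker (d i) when 0 -> M -> C (i + 1) -> C i is   *)
(* exact.                                                                      *)
Definition Gorenstein_projective (R : pzRingType) (M : lmodType R) : Prop :=
  exists (C : int -> lmodType R) (d : forall i : int, {linear C (i + 1) -> C i}),
    [/\ forall i : int, projective (C i),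
        forall i : int, exact_at (d (i + 1)) (d i),
        forall P : lmodType R, projective P ->
          forall i : int, hom_exact_at (d (i + 1)) (d i) P
      & exists (i : int) (iota : {linear M -> C (i + 1)}),
          injective iota /\ exact_at iota (d i)].

Definition is_precover (R : pzRingType) (X : lmodType R -> Prop)
    (M G : lmodType R) (phi : {linear G -> M}) : Prop :=
  X G /\
  forall (G' : lmodType R) (phi' : {linear G' -> M}), X G' ->
    exists h : {linear G' -> G}, phi' =1 phi \o h.

Definition has_precover (R : pzRingType) (X : lmodType R -> Prop)
    (M : lmodType R) : Prop :=
  exists (G : lmodType R) (phi : {linear G -> M}), is_precover X phi.

(* Main.v *)
Require Import Defs.
From HB Require Import structures.
From mathcomp Require Import all_boot all_order all_algebra.
From mathcomp Require Import boolp classical_sets functions.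

Set Implicit Arguments.
Unset Strict Implicit.
Unset Printing Implicit Defensive.

Import GRing.Theory.
Local Open Scope ring_scope.

(** Complexes are traded for modules [F] with an endomorphism [d] such that
    [ker d = im d]: adding up an acyclic complex of projective modules over all
    degrees, and making the result free by an Eilenberg swindle, one sees that
    every cycle of the complex is a direct summand of [ker d] for such an [F] that
    is free ([Gorenstein_projective_resolve]).  The theorem then splits in two
    independent halves.

    First half: under the hypothesis on the ring, the kernel of [d] is Gorenstein
    projective as soon as [F] is free and [ker d = im d]
    ([cycles_Gorenstein_projective]).  One has to show that [Hom(F, P)] is exact
    for [P] projective.  The exactness of [Hom(F, -)] passes to the kernel of a
    surjection, so that it is enough to treat a strongly FP-injective module [E]
    in place of [P].  This is a form of fp-projective periodicity.  Let
    [E -> I^0 -> I^1 -> ...] be an injective coresolution.  Its cosyzygies are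
    again strongly FP-injective, hence it is pure exact ([cores_pure]).  Let
    [g : F -> E] vanish on [im d].  Since [F] is exact and the [I^i] are injective,
    [g] extends to a chain map from [F -> F -> F -> ...] to the coresolution.  But
    a chain map from a complex of free modules to a pure exact complex is
    null-homotopic ([null_homotopy]), and in the lowest degree a null-homotopy is
    a factorization of [g] through [d].

    Null-homotopies are built basis element by basis element.  In the complex
    [F -> F -> ...] a basis element generates, under supports of differentials,
    a subcomplex that has only finitely many basis elements in each degree.  On
    such a subcomplex, and modulo what has been treated before, the homotopy
    amounts to finite systems of linear equations, which purity solves
    ([null_homotopy_finite]); Zorn's lemma does the rest.

    Second half: for every module [M] there is a free [G] with [ker D = im D] and
    a map [phi : G -> M] that kills [im D], through which every other such
    [(F, d, f)] factors ([universal_differential]).  The reason is that [F] is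
    a transfinite union of exact subcomplexes spanned by subsets of its basis,
    with successive quotients of bounded size: closing a basis element under
    supports of differentials and of chosen preimages of cycles gives an image of
    the inductive type [term R], which depends on the ring only.  So [F] is
    obtained by attaching small acyclic blocks, and [G] is the free module on the
    inductive type of all the cells that can ever be attached.  It is exact since
    it is itself filtered by acyclic blocks ([good_acyclic]), and each attachment
    performed in [F] has been performed in [G] ([chain_lift]).

    Finally [ker D -> M], [D w |-> phi w], is the desired precover: a map to [M]
    from a Gorenstein projective module is the map induced on cycles by some
    [f : F -> M], and factors because [f] factors through [phi]. *)

(** * Linear maps, submodules and quotients *)

Section LinearMaps.
Variable R : pzRingType.
Implicit Types U V W : lmodType R.

Lemma linear_of U V (f : U -> V) : linear f -> exists g : {linear U -> V}, g =1 f.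
Proof.
move=> lf.
pose g := GRing.isLinear.Build R U V *:%R f lf.
pose h : {linear U -> V} := HB.pack f g.
by exists h.
Qed.

Lemma factor_surj U V W (p : {linear U -> V}) (f : {linear U -> W}) :
  surjective p -> (forall x, p x = 0 -> f x = 0) ->
  exists g : {linear V -> W}, forall x, g (p x) = f x.
Proof.
move=> p_surj fK; have [s sK] := boolp.choice p_surj.
have fE x y : p x = p y -> f x = f y.
  by move=> pxy; apply/subr0_eq; rewrite -linearB fK // linearB /= pxy subrr.
have [|g gE] := @linear_of _ _ (f \o s).
  by move=> a x y /=; rewrite -linearP; apply: fE; rewrite linearP /= !sK.
by exists g => x; rewrite gE /=; apply: fE; rewrite sK.
Qed.

Lemma factor_inj U V W (i : {linear V -> W}) (f : {linear U -> W}) :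
  injective i -> (forall x, exists y, i y = f x) ->
  exists g : {linear U -> V}, forall x, i (g x) = f x.
Proof.
move=> i_inj /boolp.choice[h hE].
have [|g gE] := @linear_of _ _ h.
  by move=> a x y; apply: i_inj; rewrite linearP /= !hE linearP.
by exists g => x; rewrite gE.
Qed.

End LinearMaps.

(** Submodules are [Prop]-valued predicates, since kernels and images are not
    decidable; [spred] below is the boolean version that the subtype needs. *)
Record submodule (R : pzRingType) (V : lmodType R) := Submodule {
  smem :> V -> Prop;
  smem0 : smem 0;
  smemP : forall a x y, smem x -> smem y -> smem (a *: x + y) }.

Section Submodules.
Variables (R : pzRingType) (V : lmodType R) (S : submodule V).

Lemma smemD x y : S x -> S y -> S (x + y).
Proof. by move=> Sx Sy; rewrite -[x]scale1r; apply: smemP. Qed.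
Lemma smemZ a x : S x -> S (a *: x).
Proof. by move=> Sx; rewrite -[_ *: _]addr0; apply: smemP (smem0 _). Qed.
Lemma smemN x : S x -> S (- x).
Proof. by rewrite -scaleN1r; apply: smemZ. Qed.
Lemma smemB x y : S x -> S y -> S (x - y).
Proof. by move=> Sx Sy; apply/smemD/smemN. Qed.
Definition spred : {pred V} := fun x => `[< S x >].

Lemma spred_submod : submod_closed spred.
Proof.
split; first by apply/asboolP/smem0.
by move=> a x y /asboolP Sx /asboolP Sy; apply/asboolP/smemP.
Qed.
HB.instance Definition _ := GRing.isSubmodClosed.Build R V spred spred_submod.

Record subm := Subm { subm_val : V; subm_prop : subm_val \in spred }.
HB.instance Definition _ := [isSub for subm_val].
HB.instance Definition _ := [Choice of subm by <:].
HB.instance Definition _ := [SubChoice_isSubLmodule of subm by <:].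

Definition incl : {linear subm -> V} := \val.

Lemma incl_inj : injective incl. Proof. exact: val_inj. Qed.
Lemma incl_mem x : S (incl x). Proof. by case: x => x /= /asboolP. Qed.
Lemma incl_surj x : S x -> exists y, incl y = x.
Proof. by move=> /asboolP Sx; exists (Subm Sx). Qed.

(** The quotient is the type of chosen representatives: as the choice depends only
    on the predicate [S (_ - x)], congruent elements have the same one. *)
Definition coset_rep (x : V) : V := xget 0 [set y | S (y - x)].

Lemma coset_repP x : S (coset_rep x - x).
Proof.
apply: (@xgetPex _ 0 [set y | S (y - x)]).
by exists x => /=; rewrite subrr; apply: smem0.
Qed.
Lemma coset_rep_eq x y : S (x - y) -> coset_rep x = coset_rep y.
Proof.
move=> Sxy; congr xget; apply/seteqP; split => z /= Sz.
  by rewrite -(subrKA x); apply: smemD.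
by rewrite -(subrKA y); apply: smemD => //; rewrite -opprB; apply: smemN.
Qed.

Record quot := Quot { quot_val : V; quot_prop : coset_rep quot_val == quot_val }.
HB.instance Definition _ := [isSub for quot_val].
HB.instance Definition _ := [Choice of quot by <:].

Lemma coset_repK x : coset_rep (coset_rep x) == coset_rep x.
Proof. exact/eqP/coset_rep_eq/coset_repP. Qed.
Definition quot_class x : quot := Quot (coset_repK x).

Lemma quot_classE x y : S (x - y) -> quot_class x = quot_class y.
Proof. by move=> Sxy; apply/val_inj/coset_rep_eq. Qed.
Lemma quot_classK (z : quot) : quot_class (val z) = z.
Proof. by apply/val_inj/eqP/(valP z). Qed.

Let qadd (x y : quot) := quot_class (val x + val y).
Let qopp (x : quot) := quot_class (- val x).
Let qscale (a : R) (x : quot) := quot_class (a *: val x).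

Let qaddE x y : qadd (quot_class x) (quot_class y) = quot_class (x + y).
Proof. by apply: quot_classE; rewrite opprD addrACA; apply: smemD; apply: coset_repP. Qed.
Let qscaleE a x : qscale a (quot_class x) = quot_class (a *: x).
Proof. by apply: quot_classE; rewrite -scalerBr; apply/smemZ/coset_repP. Qed.
Let qoppE x : qopp (quot_class x) = quot_class (- x).
Proof. by apply: quot_classE; rewrite -opprD; apply/smemN/coset_repP. Qed.

Let qaddA : associative qadd.
Proof.
by move=> x y z; rewrite -[x]quot_classK -[y]quot_classK -[z]quot_classK !qaddE addrA.
Qed.
Let qaddC : commutative qadd.
Proof. by move=> x y; rewrite /qadd addrC. Qed.
Let qadd0 : left_id (quot_class 0) qadd.
Proof. by move=> x; rewrite -[x]quot_classK !qaddE add0r. Qed.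
Let qaddN : left_inverse (quot_class 0) qopp qadd.
Proof. by move=> x; rewrite -[x]quot_classK qoppE !qaddE addNr. Qed.
HB.instance Definition _ := GRing.isZmodule.Build quot qaddA qaddC qadd0 qaddN.

Let qscaleA a b v : qscale a (qscale b v) = qscale (a * b) v.
Proof. by rewrite -[v]quot_classK !qscaleE scalerA. Qed.
Let qscale1 : left_id 1 qscale.
Proof. by move=> x; rewrite -[x]quot_classK qscaleE scale1r. Qed.
Let qscaleDr : right_distributive qscale +%R.
Proof.
move=> a x y; rewrite -[x]quot_classK -[y]quot_classK.
by rewrite [X in qscale _ X]qaddE !qscaleE [RHS]qaddE scalerDr.
Qed.
Let qscaleDl v : {morph qscale^~ v : a b / a + b}.
Proof.
by move=> a b /=; rewrite -[v]quot_classK !qscaleE [RHS]qaddE scalerDl.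
Qed.
HB.instance Definition _ :=
  GRing.Zmodule_isLmodule.Build R quot qscaleA qscale1 qscaleDr qscaleDl.

Let quot_class_linear : linear quot_class.
Proof. by move=> a x y; rewrite -[RHS]/(qadd (qscale _ _) _) qscaleE qaddE. Qed.
HB.instance Definition _ := GRing.isLinear.Build R V quot *:%R quot_class quot_class_linear.

Definition qproj : {linear V -> quot} := quot_class.

Lemma qproj_surj : surjective qproj.
Proof. by move=> z; exists (val z); apply: quot_classK. Qed.
Lemma qproj_ker x : qproj x = 0 <-> S x.
Proof.
split=> [|Sx]; last by apply: quot_classE; rewrite subr0.
move=> /(congr1 val) /= repx.
have := coset_repP x; rewrite repx => /smemN; rewrite opprB => Sx.
by rewrite -(subrK (coset_rep 0) x); apply: smemD => //; rewrite -(subr0 (coset_rep 0)); apply: coset_repP.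
Qed.

End Submodules.
Arguments incl {R V S}.
Arguments qproj {R V}.

Section KerImg.
Variables (R : pzRingType) (U V : lmodType R) (f : {linear U -> V}).

Let ker0 : f 0 = 0. Proof. exact: linear0. Qed.
Let kerP a x y : f x = 0 -> f y = 0 -> f (a *: x + y) = 0.
Proof. by rewrite linearP => -> ->; rewrite scaler0 addr0. Qed.
Definition ker_sub : submodule U := @Submodule R U (fun x => f x = 0) ker0 kerP.

Let img0 : exists x, f x = 0. Proof. by exists 0; apply: linear0. Qed.
Let imgP a y z :
  (exists x, f x = y) -> (exists x, f x = z) -> exists x, f x = a *: y + z.
Proof. by case=> x <- [x' <-]; exists (a *: x + x'); rewrite linearP. Qed.
Definition img_sub : submodule V :=
  @Submodule R V (fun y => exists x, f x = y) img0 imgP.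

Lemma image_factor : exists p : {linear U -> subm img_sub},
  surjective p /\ forall x, incl (p x) = f x.
Proof.
have [p pE] : exists p : {linear U -> subm img_sub}, forall x, incl (p x) = f x.
  apply: factor_inj; first exact: incl_inj.
  by move=> x; apply: (@incl_surj _ _ img_sub); exists x.
exists p; split=> // y; have [x xE] := incl_mem y; exists x.
by apply: incl_inj; rewrite pE.
Qed.

Lemma kernel_factor (W : lmodType R) (g : {linear W -> U}) :
  (forall x, f (g x) = 0) ->
  exists p : {linear W -> subm ker_sub}, forall x, incl (p x) = g x.
Proof.
move=> fg; apply: factor_inj; first exact: incl_inj.
by move=> x; apply: (@incl_surj _ _ ker_sub).
Qed.

End KerImg.

(** * Free modules *)

Section FreeModule.
Variables (R : pzRingType) (B : choiceType).

Definition finitely_supported (f : B -> R^o) : Prop :=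
  exists s : seq B, forall b, f b != 0 -> b \in s.

Lemma finsupp0 : finitely_supported 0.
Proof. by exists [::] => b; rewrite eqxx. Qed.
Lemma finsuppP a f g :
  finitely_supported f -> finitely_supported g -> finitely_supported (a *: f + g).
Proof.
move=> [s sP] [t tP]; exists (s ++ t) => b; rewrite mem_cat.
apply: contraNT; rewrite negb_or => /andP[bs bt].
have /eqP f0 : f b == 0 by apply: contraNT bs; apply: sP.
have /eqP g0 : g b == 0 by apply: contraNT bt; apply: tP.
by apply/eqP; change (a *: f b + g b = 0); rewrite f0 g0 scaler0 addr0.
Qed.

Definition finsupp_sub : submodule (B -> R^o) :=
  @Submodule R (B -> R^o) finitely_supported finsupp0 finsuppP.

Definition free : lmodType R := subm finsupp_sub.
Definition coef (x : free) (b : B) : R := incl x b.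

Lemma coefP (x y : free) : (forall b, coef x b = coef y b) -> x = y.
Proof. by move=> xy; apply/incl_inj/funext. Qed.
Lemma coefD (x y : free) b : coef (x + y) b = coef x b + coef y b.
Proof. by []. Qed.
Lemma coefB (x y : free) b : coef (x - y) b = coef x b - coef y b.
Proof. by []. Qed.
Lemma coefZ a (x : free) b : coef (a *: x) b = a * coef x b.
Proof. by []. Qed.
Lemma coef0 b : coef 0 b = 0. Proof. by []. Qed.
Lemma coef_sum I (r : seq I) (P : pred I) (F : I -> free) b :
  coef (\sum_(i <- r | P i) F i) b = \sum_(i <- r | P i) coef (F i) b.
Proof. by elim/big_rec2: _ => // i x y _ <-. Qed.

Lemma free_supp_ex (x : free) :
  exists s : seq B, uniq s /\ forall b, (b \in s) = (coef x b != 0).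
Proof.
have [s sP] := incl_mem x.
exists [seq b <- undup s | coef x b != 0]; split.
  by rewrite filter_uniq ?undup_uniq.
by move=> b; rewrite mem_filter mem_undup andb_idr //; apply: sP.
Qed.
Definition supp (x : free) : seq B := sval (cid (free_supp_ex x)).
Lemma supp_uniq x : uniq (supp x). Proof. by rewrite /supp; case: cid => s []. Qed.
Lemma mem_supp x b : (b \in supp x) = (coef x b != 0).
Proof. by rewrite /supp; case: cid => s []. Qed.

Lemma gen_ex (b : B) : exists x : free, forall c, coef x c = (c == b)%:R.
Proof.
have [|x xE] := @incl_surj _ _ finsupp_sub (fun c => (c == b)%:R).
  by exists [:: b] => c; rewrite inE; case: (c =P b) => // _; rewrite eqxx.
by exists x => c; rewrite /coef xE.
Qed.
Definition fgen (b : B) : free := sval (cid (gen_ex b)).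
Lemma coef_gen b c : coef (fgen b) c = (c == b)%:R.
Proof. by rewrite /fgen; case: cid. Qed.

Lemma free_expand (s : seq B) (x : free) : uniq s ->
  (forall b, coef x b != 0 -> b \in s) -> x = \sum_(b <- s) coef x b *: fgen b.
Proof.
move=> us sP; apply: coefP => c; rewrite coef_sum.
have [cs|cs] := boolP (c \in s).
  rewrite (bigD1_seq c) //= coefZ coef_gen eqxx mulr1 big1 ?addr0 // => b bc.
  by rewrite coefZ coef_gen eq_sym (negPf bc) mulr0.
have /eqP -> : coef x c == 0 by apply: contraNT cs; apply: sP.
rewrite big_seq big1 // => b bs; rewrite coefZ coef_gen.
by case: eqP => [cb|]; [rewrite cb bs in cs|rewrite mulr0].
Qed.

Lemma free_sum_supp (x : free) : x = \sum_(b <- supp x) coef x b *: fgen b.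
Proof. by apply: free_expand (supp_uniq x) _ => b; rewrite mem_supp. Qed.

Section Lift.
Variables (V : lmodType R) (v : B -> V).

Definition flin_fun (x : free) : V := \sum_(b <- supp x) coef x b *: v b.

Lemma flin_sum (s : seq B) (x : free) : uniq s ->
  (forall b, coef x b != 0 -> b \in s) ->
  flin_fun x = \sum_(b <- s) coef x b *: v b.
Proof.
move=> us sP; rewrite /flin_fun.
rewrite [RHS](bigID (fun b => coef x b != 0)) /= [X in _ + X]big1 ?addr0.
  rewrite -[RHS]big_filter; apply: perm_big; apply: uniq_perm.
  - exact: supp_uniq.
  - by rewrite filter_uniq.
  by move=> b; rewrite mem_filter mem_supp andb_idr //; apply: sP.
by move=> b /negPn/eqP ->; rewrite scale0r.
Qed.

Lemma flin_linear : linear flin_fun.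
Proof.
move=> a x y; set s := undup (supp x ++ supp y).
have us : uniq s by apply: undup_uniq.
have sx b : coef x b != 0 -> b \in s by rewrite mem_undup mem_cat mem_supp => ->.
have sy b : coef y b != 0 -> b \in s.
  by rewrite mem_undup mem_cat (mem_supp y) => ->; rewrite orbT.
rewrite (flin_sum us sx) (flin_sum us sy) (@flin_sum s) //; last first.
  move=> b; rewrite coefD coefZ; apply: contraNT => bs.
  have /eqP -> : coef x b == 0 by apply: contraNT bs; apply: sx.
  have /eqP -> : coef y b == 0 by apply: contraNT bs; apply: sy.
  by rewrite mulr0 addr0.
rewrite scaler_sumr -big_split; apply: eq_bigr => b _ /=.
by rewrite coefD coefZ scalerDl scalerA.
Qed.
Lemma flin_ex : exists f : {linear free -> V}, forall b, f (fgen b) = v b.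
Proof.
have [f fE] := linear_of flin_linear; exists f => b.
rewrite fE (@flin_sum [:: b]) ?big_seq1 ?coef_gen ?eqxx ?scale1r // => c.
by rewrite coef_gen inE; case: (c == b); rewrite ?eqxx.
Qed.
Definition flin : {linear free -> V} := sval (cid flin_ex).

Lemma flin_gen b : flin (fgen b) = v b.
Proof. by rewrite /flin; case: cid. Qed.
Lemma flinE (x : free) : flin x = \sum_(b <- supp x) coef x b *: v b.
Proof.
rewrite {1}(free_sum_supp x) linear_sum; apply: eq_bigr => b _.
by rewrite linearZ /= flin_gen.
Qed.
End Lift.

Definition supported (A : B -> Prop) (x : free) : Prop :=
  forall b, coef x b != 0 -> A b.

Section Supported.
Variable A : B -> Prop.
Lemma supportedC0 : supported A 0. Proof. by move=> b; rewrite coef0 eqxx. Qed.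
Lemma supportedP a x y : supported A x -> supported A y -> supported A (a *: x + y).
Proof.
move=> Ax Ay b; rewrite coefD coefZ; have [->|/Ax//] := eqVneq (coef x b) 0.
by have [->|/Ay//] := eqVneq (coef y b) 0; rewrite mulr0 addr0 eqxx.
Qed.
Definition supported_sub : submodule free := @Submodule R free (supported A) supportedC0 supportedP.
End Supported.

Lemma supported_gen (A : B -> Prop) b : A b -> supported A (fgen b).
Proof. by move=> Ab c; rewrite coef_gen; case: (c =P b) => [->//|_]; rewrite eqxx. Qed.

Lemma supportedS (A A' : B -> Prop) x :
  (forall b, A b -> A' b) -> supported A x -> supported A' x.
Proof. by move=> AA' Ax b /Ax/AA'. Qed.

Lemma supported_supp A x : supported A x -> forall b, b \in supp x -> A b.
Proof. by move=> Ax b; rewrite mem_supp => /Ax. Qed.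

Lemma flin_mem (V : lmodType R) (S : submodule V) (f : {linear free -> V}) A x :
  (forall b, A b -> S (f (fgen b))) -> supported A x -> S (f x).
Proof.
move=> Sf Ax; rewrite (free_sum_supp x) linear_sum /= big_seq.
elim/big_rec: _ => [|b y bx Sy]; first exact: smem0.
apply: smemD => //; rewrite linearZ; apply: smemZ; apply: Sf.
exact: supported_supp bx.
Qed.

Lemma eq_on_supported (V : lmodType R) (f g : {linear free -> V}) A x :
  (forall b, A b -> f (fgen b) = g (fgen b)) -> supported A x -> f x = g x.
Proof.
move=> fg Ax; rewrite (free_sum_supp x) !linear_sum !big_seq.
by apply: eq_bigr => b bx; rewrite !linearZ /= fg //; apply: supported_supp bx.
Qed.

Lemma eq_on_gen (V : lmodType R) (f g : {linear free -> V}) :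
  (forall b, f (fgen b) = g (fgen b)) -> f =1 g.
Proof. by move=> fg x; apply: (@eq_on_supported _ _ _ (fun=> True)). Qed.

Definition restr (A : B -> Prop) : {linear free -> free} :=
  flin (fun b => if `[< A b >] then fgen b else 0).

Lemma coef_restr A x b : coef (restr A x) b = if `[< A b >] then coef x b else 0.
Proof.
rewrite {1}[x]free_sum_supp linear_sum coef_sum.
have [bx|bx] := boolP (b \in supp x); last first.
  have /eqP -> : coef x b == 0 by rewrite mem_supp negbK in bx.
  rewrite if_same big_seq big1 // => c cx; rewrite linearZ /= coefZ.
  rewrite /restr flin_gen; case: ifP => _; rewrite ?coef0 ?mulr0 // coef_gen.
  case: (b =P c) => [bc|_]; last by rewrite mulr0.
  by rewrite -bc (negPf bx) in cx.
rewrite (bigD1_seq b) ?supp_uniq //= linearZ /= coefZ /restr flin_gen big1.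
  by case: ifP; rewrite ?coef0 ?coef_gen ?eqxx ?mulr1 ?mulr0 addr0.
move=> c cb; rewrite linearZ /= coefZ flin_gen.
by case: ifP; rewrite ?coef0 ?coef_gen 1?eq_sym ?(negPf cb) mulr0.
Qed.

Lemma restr_supported A x : supported A (restr A x).
Proof. by move=> b; rewrite coef_restr; case: asboolP => //; rewrite eqxx. Qed.
Lemma restr_id A x : supported A x -> restr A x = x.
Proof.
move=> Ax; apply: coefP => b; rewrite coef_restr; case: asboolP => // Ab.
by apply/esym/eqP; apply: contra_notT Ab; apply: Ax.
Qed.
Lemma restr_compl A x : supported (fun b => ~ A b) (x - restr A x).
Proof.
by move=> b; rewrite coefB coef_restr; case: asboolP => //; rewrite subrr eqxx.
Qed.
Lemma restr_eq0 A x : supported (fun b => ~ A b) x -> restr A x = 0.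
Proof.
move=> Ax; apply: coefP => b; rewrite coef_restr coef0; case: asboolP => // Ab.
by apply/eqP; apply: contraPT Ab; apply: Ax.
Qed.

Lemma supported0 x : supported (fun=> False) x -> x = 0.
Proof. by move=> sx; apply: coefP => b; apply/eqP/negPn/negP => /sx. Qed.

Lemma free_projective : projective free.
Proof.
move=> U W p f p_surj; have [s sK] := boolp.choice p_surj.
exists (flin (fun b => s (f (fgen b)))) => x /=; move: x.
apply: (@eq_on_gen _ f (p \o flin (fun b => s (f (fgen b))))) => b /=.
by rewrite flin_gen sK.
Qed.

End FreeModule.
Arguments fgen {R B}.
Arguments supported_sub {R B}.
Arguments restr {R B}.
Arguments free R B : clear implicits.

Definition free_hull (R : pzRingType) (V : lmodType R) : {linear free R V -> V} :=
  flin (fun v => v).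

Lemma free_hull_gen (R : pzRingType) (V : lmodType R) (v : V) :
  free_hull V (fgen v) = v.
Proof. exact: flin_gen. Qed.

Lemma free_hull_surj (R : pzRingType) (V : lmodType R) : surjective (free_hull V).
Proof. by move=> v; exists (fgen v); rewrite free_hull_gen. Qed.

Lemma supported_ind (R : pzRingType) (B : choiceType) (A : B -> Prop)
    (P : free R B -> Prop) :
  P 0 -> (forall a b y, A b -> P y -> P (a *: fgen b + y)) ->
  forall x, supported A x -> P x.
Proof.
move=> P0 PD x Ax; rewrite (free_sum_supp x) big_seq.
by elim/big_rec: _ => // b y bx; apply: PD; apply: supported_supp bx.
Qed.

(** * Zorn's lemma for partial functions *)

(** A partial function is a pair of a domain and a total function of which only
    the values on the domain matter; this avoids dependent domains.  Three later
    constructions are unions of chains of such partial functions: extensions of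
    homomorphisms, null-homotopies, and lifts of chain maps. *)
Section PartialFunctions.
Variables (X : Type) (Y : X -> Type).

Definition pfun : Type := (X -> Prop) * (forall x, Y x).
Definition pext (s t : pfun) : Prop :=
  (forall x, s.1 x -> t.1 x) /\ (forall x, s.1 x -> t.2 x = s.2 x).

Lemma pext_refl s : pext s s. Proof. by []. Qed.
Lemma pext_trans r s t : pext r s -> pext s t -> pext r t.
Proof.
move=> [rs1 rs2] [st1 st2]; split=> x rx; first exact/st1/rs1.
by rewrite st2 ?rs2 //; apply: rs1.
Qed.

Definition pchain (P : pfun -> Prop) (C : pfun -> Prop) : Prop :=
  [/\ exists s, C s, forall s, C s -> P s
    & forall s t, C s -> C t -> pext s t \/ pext t s].

Definition punion (C : pfun -> Prop) (x : X) : Prop := exists2 s, C s & s.1 x.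

Lemma zorn_partial (P : pfun -> Prop) (s0 : pfun) : P s0 ->
  (forall C g, pchain P C -> (forall s, C s -> forall x, s.1 x -> g x = s.2 x) ->
     P (punion C, g)) ->
  exists m, [/\ P m, pext s0 m
              & forall t, P t -> pext m t -> forall x, t.1 x -> m.1 x].
Proof.
move=> Ps0 Punion.
pose T := {s : pfun | P s /\ pext s0 s}.
pose le (s t : T) := `[< pext (sval s) (sval t) >].
have [||C tC|m mmax] := @ZL_preorder T (exist _ s0 (conj Ps0 (pext_refl _))) le.
- by move=> t; apply/asboolP/pext_refl.
- by move=> r s t /asboolP rs /asboolP st; apply/asboolP/(pext_trans rs).
- have [[t Ct]|nC] := pselect (exists t, C t); last first.
    exists (exist _ s0 (conj Ps0 (pext_refl _))) => s Cs.
    by case: nC; exists s.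
  pose C' := fun s => exists2 t : T, C t & sval t = s.
  have C'tot s r : C' s -> C' r -> pext s r \/ pext r s.
    move=> [{}s Cs <-] [{}r Cr <-].
    by case: (tC _ _ Cs Cr) => /asboolP; [left|right].
  have [g gE] : exists g : forall x, Y x,
      forall s, C' s -> forall x, s.1 x -> g x = s.2 x.
    pose G x := if pselect (exists s, C' s /\ s.1 x) is left e
                then (sval (cid e)).2 x else s0.2 x.
    exists G => s C's x sx; rewrite /G.
    case: pselect => [e|[]]; last by exists s.
    case: cid => r [/= C'r rx].
    by case: (C'tot _ _ C's C'r) => -[_ ->].
  have C'chain : pchain P C'.
    split=> //; first by exists (sval t), t.
    by move=> _ [[s [Ps /= _]] _ <-].
  have ext s : C' s -> pext s (punion C', g).
    by move=> C's; split=> x sx /=; [exists s|apply: gE C's _ sx].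
  have s0g : pext s0 (punion C', g).
    case: t Ct => t [Pt s0t] Ct; apply: (pext_trans s0t); apply: ext.
    by exists (exist _ t (conj Pt s0t)).
  exists (exist _ (punion C', g) (conj (Punion _ _ C'chain gE) s0g)) => s Cs.
  by apply/asboolP/ext; exists s.
case: m mmax => m [Pm s0m] mmax; exists m; split=> // t Pt mt x tx.
have := mmax (exist _ t (conj Pt (pext_trans s0m mt))).
by case/(_ (introT (asboolP _) mt))/asboolP => + _; apply.
Qed.

End PartialFunctions.

Lemma pchain_seq (X : eqType) (Y : X -> Type) (P C : pfun Y -> Prop) (l : seq X) :
  pchain P C -> (forall x, x \in l -> punion C x) ->
  exists2 s, C s & forall x, x \in l -> s.1 x.
Proof.
move=> [[s0 Cs0] CP Ctot]; elim: l => [|x l IHl] lC; first by exists s0.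
have [|s Cs sl] := IHl; first by move=> y yl; apply: lC; rewrite inE yl orbT.
have [t Ct tx] := lC x (mem_head x l).
have [[st _]|[ts _]] := Ctot _ _ Cs Ct.
  by exists t => // y; rewrite inE => /predU1P[->//|/sl/st].
by exists s => // y; rewrite inE => /predU1P[->|/sl//]; apply: ts.
Qed.

(** * Enough injectives *)

Section DivisibleExtension.
Variables (V D : zmodType).
Hypothesis divD : forall n (y : D), (0 < n)%N -> exists z : D, z *+ n = y.

Definition partial_hom (s : @pfun V (fun=> D)) : Prop :=
  s.1 0 /\ forall x y, s.1 x -> s.1 y -> s.1 (x - y) /\ s.2 (x - y) = s.2 x - s.2 y.

Section PartialHomTheory.
Variables (s : @pfun V (fun=> D)) (sP : partial_hom s).

Lemma phom0 : s.2 0 = 0.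
Proof. by have [s0 sB] := sP; have [_] := sB _ _ s0 s0; rewrite !subrr. Qed.
Lemma phomB x y : s.1 x -> s.1 y -> s.1 (x - y) /\ s.2 (x - y) = s.2 x - s.2 y.
Proof. exact: sP.2. Qed.
Lemma phomN x : s.1 x -> s.1 (- x) /\ s.2 (- x) = - s.2 x.
Proof. by move=> sx; have := phomB sP.1 sx; rewrite phom0 !sub0r. Qed.
Lemma phomD x y : s.1 x -> s.1 y -> s.1 (x + y) /\ s.2 (x + y) = s.2 x + s.2 y.
Proof.
move=> sx sy; have [sNy Ny] := phomN sy.
by have := phomB sx sNy; rewrite Ny !opprK.
Qed.
Lemma phomMn x n : s.1 x -> s.1 (x *+ n) /\ s.2 (x *+ n) = s.2 x *+ n.
Proof.
move=> sx; elim: n => [|n [sn En]]; first by split; [apply: sP.1|apply: phom0].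
by rewrite !mulrS; have [? ->] := phomD sx sn; rewrite En.
Qed.
Lemma phomMz x (n : int) : s.1 x -> s.1 (x *~ n) /\ s.2 (x *~ n) = s.2 x *~ n.
Proof.
move=> sx; case: n => n; first exact: phomMn.
have [sn En] := phomMn n.+1 sx.
by rewrite NegzE !mulrNz -!pmulrn; have [? ->] := phomN sn; rewrite En.
Qed.

(** The values of a homomorphism on the multiples of [x] that lie in its domain are
    prescribed by the least positive such multiple, which divisibility solves. *)
Lemma divisible_value (x : V) :
  exists y : D, forall n : int, s.1 (x *~ n) -> y *~ n = s.2 (x *~ n).
Proof.
have [exn|nexn] := pselect (exists n, (0 < n)%N && `[< s.1 (x *+ n) >]); last first.
  exists 0 => n sn; rewrite mul0rz.
  suff -> : n = 0 by rewrite mulr0z phom0.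
  apply: contrapT => /eqP n0; case: nexn; exists `|n|%N.
  rewrite absz_gt0 n0; apply/asboolP.
  case: n sn {n0} => n //; rewrite NegzE mulrNz => sn.
  by have [] := phomN sn; rewrite opprK.
case: (ex_minnP exn) => n0 /andP[n0_gt0 /asboolP sn0] n0min.
have [z zE] := divD (s.2 (x *+ n0)) n0_gt0.
exists z => n sn.
have n0P : n = (n %/ n0)%Z * n0.
  have n0neq : n0%:Z != 0 by rewrite -lt0n.
  rewrite [LHS](divz_eq n n0) -[RHS]addr0; congr (_ + _).
  have := modz_ge0 n n0neq; have := ltz_pmod n (n0_gt0 : 0 < n0%:Z).
  case E : (n %% n0)%Z => [r|//] rn0 _; rewrite ltz_nat in rn0.
  case: r => // r in E rn0 *; exfalso.
  suff /n0min : (0 < r.+1)%N && `[< s.1 (x *+ r.+1) >] by rewrite leqNgt rn0.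
  apply/andP; split=> //; apply/asboolP.
  have -> : x *+ r.+1 = x *~ n - (x *+ n0) *~ (n %/ n0)%Z.
    rewrite [in x *~ n](divz_eq n n0) E mulrzDr [_ * n0%:Z]mulrC mulrzA.
    by rewrite pmulrn addrAC subrr add0r.
  by apply: (phomB _ _).1 => //; apply: (phomMz _ _).1.
rewrite n0P mulrC !mulrzA -!pmulrn zE.
by have [_ ->] := phomMz (n %/ n0)%Z sn0.
Qed.

Lemma phom_extend (x : V) : exists t, [/\ partial_hom t, pext s t & t.1 x].
Proof.
have [y yP] := divisible_value x.
pose val z d := exists a (k : int), [/\ s.1 a, z = a + x *~ k & d = s.2 a + y *~ k].
have val_uniq z d d' : val z d -> val z d' -> d = d'.
  move=> [a [k [sa -> ->]]] [b [l [sb ab ->]]].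
  have E : x *~ (k - l) = b - a.
    rewrite mulrzBr; apply/eqP; rewrite subr_eq addrAC eq_sym subr_eq -ab.
    by rewrite addrC.
  have [sba Eba] := phomB sb sa.
  have := yP (k - l); rewrite E Eba mulrzBr => /(_ sba) H.
  by apply/eqP; rewrite -subr_eq -addrA H addrC subrK.
pose f z := xget 0 [set d | val z d].
have fE z d : val z d -> f z = d.
  by move=> zd; apply: (val_uniq z) => //; apply: (@xgetI _ 0 [set d | val z d] d).
exists (fun z => exists d, val z d, f); split.
- split=> [|z z' [d zd] [d' zd']] /=.
    exists 0, 0, 0; split; first exact: sP.1.
      by rewrite mulr0z addr0.
    by rewrite phom0 mulr0z addr0.
  rewrite (fE _ _ zd) (fE _ _ zd').
  have v : val (z - z') (d - d').
    move: zd zd' => [a [k [sa -> ->]]] [b [l [sb -> ->]]].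
    have [sab Eab] := phomB sa sb.
    by exists (a - b), (k - l); rewrite Eab !mulrzBr !opprD; split=> //; rewrite addrACA.
  by split; [exists (d - d')|apply: fE].
- have v z : s.1 z -> val z (s.2 z).
    by move=> sz; exists z, 0; rewrite !mulr0z !addr0.
  by split=> z /v sz /=; [exists (s.2 z)|apply: fE].
- by exists y, 0, 1; rewrite !mulr1z phom0 !add0r; split=> //; apply: sP.1.
Qed.
End PartialHomTheory.

(** Baer's criterion over the integers: a maximal extension is total, because a
    domain that misses [x] can be enlarged by the multiples of [x]. *)
Lemma divisible_extension (s : @pfun V (fun=> D)) : partial_hom s ->
  exists f : V -> D, {morph f : x y / x - y} /\ forall x, s.1 x -> f x = s.2 x.
Proof.
move=> sP.
have [C g [[s0 Cs0] CP Ctot] gE|m [mP [_ sm] mmax]] := zorn_partial sP.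
  split; first by exists s0 => //; apply: (CP _ Cs0).1.
  move=> x y [s1 C1 x1] [s2 C2 y2] /=.
  have [t Ct [tx ty]] : exists2 t, C t & t.1 x /\ t.1 y.
    by have [[/(_ _ x1)]|[/(_ _ y2)]] := Ctot _ _ C1 C2; [exists s2|exists s1].
  have [txy Exy] := phomB (CP _ Ct) tx ty.
  by split; [exists t|rewrite !(gE t)].
have mT x : m.1 x by have [t [tP mt tx]] := phom_extend mP x; apply: mmax tx.
exists m.2; split=> [x y|x sx]; last exact: sm.
by have [_] := phomB mP (mT x) (mT y).
Qed.

End DivisibleExtension.

(** An abelian group [E] is [Z^(E) / K] for the group [K] of relations between its
    elements, and so it embeds into the divisible group [Q^(E) / K]. *)
Section DivisibleHull.
Variable E : zmodType.

Let Q : zmodType := free rat E.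
Let ratl : {linear free int E -> zmodule Q} := flin (fun e => fgen e : zmodule Q).
Let eval : {linear free int E -> zmodule E} := flin (fun e => e : zmodule E).

Let evalE e : eval (fgen e) = e. Proof. exact: flin_gen. Qed.
Let ratE e : ratl (fgen e) = fgen e. Proof. exact: flin_gen. Qed.

Let coef_ratl l e : coef (ratl l : Q) e = (coef l e)%:~R.
Proof.
have [us sP] := (supp_uniq l, @mem_supp _ _ l).
rewrite /ratl flinE; move: (supp l) us sP => s us sP.
transitivity (coef (\sum_(b <- s) (coef l b)%:~R *: (fgen b : free rat E)) e).
  by congr (coef _ e); apply: eq_bigr => b _; rewrite scaler_int.
rewrite coef_sum; under eq_bigr do rewrite coefZ coef_gen.
have [es|es] := boolP (e \in s).
  rewrite (bigD1_seq e) //= eqxx mulr1 big1 ?addr0 // => b be.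
  by rewrite eq_sym (negPf be) mulr0.
have /eqP -> : coef l e == 0 by rewrite sP negbK in es.
rewrite big_seq big1 // => b bs; case: eqP => [eb|_]; last by rewrite mulr0.
by rewrite eb bs in es.
Qed.

Let relQ (y : zmodule Q) : Prop := exists2 l, eval l = 0 & ratl l = y.
Let relQ0 : relQ 0. Proof. by exists 0; rewrite linear0. Qed.
Let relQP a x y : relQ x -> relQ y -> relQ (a *: x + y).
Proof.
case=> l l0 <- [k k0 <-]; exists (a *: l + k); last exact: linearP.
by rewrite linearP [X in _ *: X + _]l0 k0 scaler0 addr0.
Qed.
Let K := @Submodule _ (zmodule Q) relQ relQ0 relQP.

Lemma divisible_hull : exists (D : zmodType) (j : E -> D),
  [/\ forall n (y : D), (0 < n)%N -> exists z : D, z *+ n = y,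
      {morph j : x y / x - y} & injective j].
Proof.
exists (quot K), (fun e => qproj K (fgen e)).
have jB : {morph (fun e => qproj K (fgen e)) : x y / x - y}.
  move=> x y; rewrite -linearB; apply/eqP; rewrite -subr_eq0 -linearB; apply/eqP.
  apply/qproj_ker; exists (fgen (x - y) - (fgen x - fgen y)).
    by rewrite !(linearB eval) !evalE subrr.
  by rewrite !(linearB ratl) !ratE.
split=> // [n y n_gt0|].
  have [q <-] := qproj_surj y.
  exists (qproj K ((n%:R : rat)^-1 *: (q : free rat E))).
  rewrite -raddfMn; congr (qproj K _).
  change ((n%:R^-1 *: (q : free rat E)) *+ n = q :> free rat E).
  by rewrite -scaler_nat scalerA divff ?scale1r // Num.Theory.pnatr_eq0 -lt0n.
suff jK e : qproj K (fgen e) = 0 -> e = 0.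
  by move=> x y jxy; apply/subr0_eq/jK; rewrite jB jxy subrr.
move=> /qproj_ker[l l0 lE].
suff El : l = fgen e by rewrite El evalE in l0.
apply: coefP => c; apply: (@intr_inj rat).
by rewrite -coef_ratl lE !coef_gen; case: (c == e).
Qed.
End DivisibleHull.

Lemma morphB_morphD (U V : zmodType) (f : U -> V) :
  {morph f : x y / x - y} -> {morph f : x y / x + y}.
Proof.
move=> fB; have f0 : f 0 = 0 by rewrite -[0 in LHS](subrr 0) fB subrr.
by move=> x y; rewrite -[y in LHS]opprK fB -[- y]sub0r fB f0 sub0r opprK.
Qed.

(** [coind R D] is [Hom_Z(R, D)], a left module through right multiplication on [R]. *)
Section Coinduced.
Variables (R : pzRingType) (D : zmodType).

Definition additive_pred : {pred R -> D} :=
  fun f => `[< {morph f : x y / x - y} >].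
Lemma additive_pred_zmod : zmod_closed additive_pred.
Proof.
split; first by apply/asboolP => x y; rewrite subrr.
move=> f g /asboolP fB /asboolP gB; apply/asboolP => x y.
change (f (x - y) - g (x - y) = (f x - g x) - (f y - g y)).
by rewrite fB gB opprD opprK addrACA opprD opprK.
Qed.
HB.instance Definition _ :=
  GRing.isZmodClosed.Build (R -> D) additive_pred additive_pred_zmod.

Record coind := Coind { coind_fun : R -> D; coind_prop : coind_fun \in additive_pred }.
HB.instance Definition _ := [isSub for coind_fun].
HB.instance Definition _ := [Choice of coind by <:].
HB.instance Definition _ := [SubChoice_isSubZmodule of coind by <:].

Lemma coindB (f : coind) : {morph coind_fun f : x y / x - y}.
Proof. by case: f => f /= /asboolP. Qed.
Lemma coindP (f g : coind) : coind_fun f =1 coind_fun g -> f = g.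
Proof. by move=> fg; apply/val_inj/funext. Qed.
Lemma coindD (f : coind) : {morph coind_fun f : x y / x + y}.
Proof. exact/morphB_morphD/coindB. Qed.

Let scale_prop (a : R) (f : coind) :
  (fun x => coind_fun f (x * a)) \in additive_pred.
Proof. by apply/asboolP => x y; rewrite mulrBl coindB. Qed.
Let scale a f := Coind (scale_prop a f).

Let scaleA a b v : scale a (scale b v) = scale (a * b) v.
Proof. by apply: coindP => x /=; rewrite mulrA. Qed.
Let scale1 : left_id 1 scale.
Proof. by move=> f; apply: coindP => x /=; rewrite mulr1. Qed.
Let scaleDr : right_distributive scale +%R.
Proof. by move=> a f g; apply: coindP. Qed.
Let scaleDl v : {morph scale^~ v : a b / a + b}.
Proof. by move=> a b; apply: coindP => x /=; rewrite mulrDr coindD. Qed.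
HB.instance Definition _ :=
  GRing.Zmodule_isLmodule.Build R coind scaleA scale1 scaleDr scaleDl.

Lemma coind_scaleE a (f : coind) x : coind_fun (a *: f) x = coind_fun f (x * a).
Proof. by []. Qed.
Lemma coind_DE (f g : coind) x : coind_fun (f + g) x = coind_fun f x + coind_fun g x.
Proof. by []. Qed.

End Coinduced.

Definition injective_module (R : pzRingType) (I : lmodType R) : Prop :=
  forall (A B : lmodType R) (i : {linear A -> B}) (f : {linear A -> I}),
  injective i -> exists g : {linear B -> I}, forall x, g (i x) = f x.

(** By adjunction [Hom_R(A, Hom_Z(R, D)) = Hom_Z(A, D)], so that injectivity of [D]
    as an abelian group gives injectivity of the coinduced module. *)
Lemma coind_injective (R : pzRingType) (D : zmodType) :
  (forall n (y : D), (0 < n)%N -> exists z : D, z *+ n = y) ->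
  injective_module (coind R D : lmodType R).
Proof.
move=> divD A B i f i_inj.
pose s2 b : D := if pselect (exists a, i a = b) is left e
                 then coind_fun (f (sval (cid e))) 1 else 0.
have s2E a : s2 (i a) = coind_fun (f a) 1.
  rewrite /s2; case: pselect => [e|[]]; last by exists a.
  by case: cid => a' /= /i_inj ->.
have [|g [gB gE]] := @divisible_extension B D divD (fun b => exists a, i a = b, s2).
  split; first by exists 0; rewrite linear0.
  move=> _ _ [a <-] [b <-] /=; split; first by exists (a - b); rewrite linearB.
  by rewrite -linearB !s2E linearB.
have gaddP b : (fun r => g (r *: b)) \in @additive_pred R D.
  by apply/asboolP => x y; rewrite scalerBl gB.
have [|h hE] := @linear_of R B (coind R D) (fun b => Coind (gaddP b)).
  move=> r b c; apply: coindP => x; rewrite coind_DE coind_scaleE /=.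
  by rewrite scalerDr scalerA (morphB_morphD gB).
exists h => a; apply: coindP => r; rewrite hE /= -linearZ gE /=; last by exists (r *: a).
by rewrite s2E linearZ coind_scaleE mul1r.
Qed.

Lemma enough_injectives (R : pzRingType) (E : lmodType R) :
  exists (I : lmodType R) (i : {linear E -> I}), injective i /\ injective_module I.
Proof.
have [D [j [divD jB j_inj]]] := divisible_hull E.
have addP x : (fun r => j (r *: x)) \in @additive_pred R D.
  by apply/asboolP => r s; rewrite scalerBl jB.
have [|h hE] := @linear_of R E (coind R D) (fun b => Coind (addP b)).
  move=> r b c; apply: coindP => x; rewrite coind_DE coind_scaleE /=.
  by rewrite scalerDr scalerA (morphB_morphD jB).
exists (coind R D), h; split; last exact: coind_injective.
move=> x y; rewrite !hE => /(congr1 (fun f => coind_fun f 1)) /=.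
by rewrite !scale1r => /j_inj.
Qed.

(** * Strongly FP-injective modules and their injective coresolutions *)

Section Resolutions.
Variables (R : pzRingType).

(** A presentation [P1 -> P0 -> F] is continued to a projective resolution by free
    covers of successive kernels.  The first terms are [P0] and [P1] on the nose,
    so that [Ext^1(F, E) = 0] speaks about maps out of [P1]. *)
Section Tower.
Variables (P1 P0 F : lmodType R) (D : {linear P1 -> P0}) (g : {linear P0 -> F}).

Fixpoint syz (n : nat) : lmodType R :=
  if n is n'.+1 then subm (ker_sub (free_hull (syz n'))) else subm (ker_sub D).

Definition res_obj (n : nat) : lmodType R :=
  match n with 0 => P0 | 1 => P1 | n'.+2 => free R (syz n') end.

Definition res_diff (n : nat) : {linear res_obj n.+1 -> res_obj n} :=
  match n with
  | 0 => D
  | 1 => incl \o free_hull (syz 0)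
  | n'.+2 => (incl : {linear syz n'.+1 -> _}) \o free_hull (syz n'.+1)
  end.

Lemma cover_ker_exact (U V : lmodType R) (f : {linear U -> V}) (K : lmodType R)
  (k : {linear K -> subm (ker_sub f)}) : surjective k ->
  exact_at ((incl : {linear subm (ker_sub f) -> U}) \o k) f.
Proof.
move=> k_surj y; split=> [|[x <-]]; last exact: (incl_mem (k x)).
by move=> /(@incl_surj _ _ (ker_sub f))[z <-]; have [x <-] := k_surj z; exists x.
Qed.

Lemma exact_at_comp_inj (A U V W : lmodType R) (k : {linear A -> U})
  (f : {linear U -> V}) (i : {linear V -> W}) :
  injective i -> exact_at k f -> exact_at k (i \o f).
Proof.
move=> i_inj kf y; split=> [/= ify|/kf /= ->]; last exact: linear0.
by apply/kf/i_inj; rewrite ify linear0.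
Qed.

Lemma presentation_resolution :
  projective P1 -> projective P0 -> exact_at D g -> surjective g ->
  projective_resolution F.
Proof.
move=> proj1 proj0 Dg g_surj.
apply: (@ProjRes R F res_obj res_diff g) => // [[|[|n]]|[|[|n]]] //.
- exact: free_projective.
- exact: (@cover_ker_exact _ _ _ _ (free_hull (syz 0)) (@free_hull_surj _ _)).
- exact/(exact_at_comp_inj (@incl_inj _ _ _))/cover_ker_exact/free_hull_surj.
- exact/(exact_at_comp_inj (@incl_inj _ _ _))/cover_ker_exact/free_hull_surj.
Defined.

Lemma Ext1_extend (E : lmodType R) (w : {linear P1 -> E}) :
  projective P1 -> projective P0 -> exact_at D g -> surjective g ->
  Ext_zero 1 F E -> (forall x, D x = 0 -> w x = 0) ->
  exists v : {linear P0 -> E}, forall x, w x = v (D x).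
Proof.
move=> proj1 proj0 Dg g_surj extE wD.
have [|v vE] := extE (presentation_resolution proj1 proj0 Dg g_surj) w; last by exists v.
move=> x; apply: wD.
exact: ((@cover_ker_exact _ _ _ _ (free_hull (syz 0)) (@free_hull_surj _ _)) _).2
  (ex_intro _ x erefl).
Qed.

End Tower.

Lemma row_linear (V : lmodType R) n (w : 'I_n -> V) :
  exists f : {linear 'rV[R]_n -> V}, forall x, f x = \sum_j x 0 j *: w j.
Proof.
apply: linear_of => a x y; rewrite scaler_sumr -big_split.
by apply: eq_bigr => j _; rewrite !mxE scalerDl scalerA.
Qed.

Lemma row_projective n : projective ('rV[R]_n).
Proof.
move=> U W p f p_surj; have [s sK] := boolp.choice p_surj.
have [h hE] := @row_linear U n (fun j => s (f (delta_mx 0 j))).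
exists h => x /=; rewrite hE linear_sum {1}[x]row_sum_delta linear_sum.
by apply: eq_bigr => j _; rewrite !linearZ /= sK.
Qed.

Lemma SFI_extend (E : lmodType R) m n (D : {linear 'rV[R]_m -> 'rV[R]_n})
    (w : {linear 'rV[R]_m -> E}) :
  strongly_FP_injective E -> (forall x, D x = 0 -> w x = 0) ->
  exists v : {linear 'rV[R]_n -> E}, forall x, w x = v (D x).
Proof.
move=> sfiE wD.
have Dg : exact_at D (qproj (img_sub D)) by move=> y; apply: qproj_ker.
apply: (Ext1_extend (@row_projective m) (@row_projective n) Dg) wD.
  exact: qproj_surj.
by apply: sfiE => //; exists m, n, D, (qproj (img_sub D)); split=> //; apply: qproj_surj.
Qed.

(** A finite system of linear equations with constants in [L] that has a solution in
    some overmodule has one in [L]: solving it means extending a map along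
    [R^m -> R^n], and the cokernel of that map is finitely presented. *)
Lemma SFI_pure (L I : lmodType R) (i : {linear L -> I}) m n (D : 'M[R]_(m, n))
    (w : 'I_m -> L) (w' : 'I_n -> I) :
  strongly_FP_injective L -> injective i ->
  (forall p, i (w p) = \sum_q D p q *: w' q) ->
  exists v : 'I_n -> L, forall p, w p = \sum_q D p q *: v q.
Proof.
move=> sfiL i_inj wE; have [fw fwE] := row_linear w.
have [fD fDE] : exists f : {linear 'rV[R]_m -> 'rV[R]_n}, forall x, f x = x *m D.
  by apply: linear_of => a x y; rewrite mulmxDl -scalemxAl.
have [x|v vE] := SFI_extend sfiL (D := fD) (w := fw).
  rewrite fDE => xD; apply: i_inj; rewrite linear0 fwE linear_sum.
  transitivity (\sum_q (x *m D) 0 q *: w' q); last first.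
    by rewrite xD big1 // => q _; rewrite mxE scale0r.
  under eq_bigr => p _ do rewrite linearZ /= wE scaler_sumr.
  rewrite exchange_big; apply: eq_bigr => q _ /=.
  by rewrite mxE scaler_suml; apply: eq_bigr => p _; rewrite scalerA.
have fwd p : fw (delta_mx 0 p) = w p.
  rewrite fwE (bigD1 p) //= mxE !eqxx scale1r big1 ?addr0 // => q qp.
  by rewrite mxE (negPf qp) scale0r.
exists (fun q => v (delta_mx 0 q)) => p.
rewrite -fwd vE fDE -rowE [row p D in LHS]row_sum_delta linear_sum.
by apply: eq_bigr => q _; rewrite linearZ /= mxE.
Qed.

Lemma injective_extend (U V I : lmodType R) (d : {linear U -> V}) (f : {linear U -> I}) :
  injective_module I -> (forall x, d x = 0 -> f x = 0) ->
  exists g : {linear V -> I}, forall x, f x = g (d x).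
Proof.
move=> injI fd.
have [p [p_surj pE]] := image_factor d.
have [|f' f'E] := @factor_surj _ _ _ _ p f p_surj.
  by move=> x px; apply: fd; rewrite -pE px linear0.
have [g gE] := injI _ _ incl f' (@incl_inj _ _ (img_sub d)).
by exists g => x; rewrite -f'E -gE pE.
Qed.

(** Dimension shift: [Ext^k(F, L) = Ext^(k+1)(F, E)] when [I] is injective. *)
Lemma SFI_cosyzygy (E I L : lmodType R) (i : {linear E -> I}) (p : {linear I -> L}) :
  strongly_FP_injective E -> injective_module I ->
  injective i -> exact_at i p -> surjective p -> strongly_FP_injective L.
Proof.
move=> sfiE injI i_inj ip p_surj [//|k] F _ fpF Q f fcoc.
have [f' f'E] := @pr_projective _ _ Q k.+1 _ _ p f p_surj.
have [e eE] : exists e : {linear pr_obj Q k.+2 -> E},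
    forall x, i (e x) = (f' \o pr_diff Q k.+1) x.
  apply: factor_inj i_inj _ => x /=.
  by apply/ip; rewrite -[p _]/((p \o f') _) -f'E; apply: fcoc.
have [|e' e'E] := @sfiE k.+2 F isT fpF Q e.
  move=> x; apply: i_inj; rewrite linear0 eE /=.
  by have /= := (@pr_exact _ _ Q k.+1 (pr_diff Q k.+2 x)).2 (ex_intro _ x erefl) => ->; rewrite linear0.
have [h hE] : exists h : {linear pr_obj Q k.+1 -> I}, forall x, h x = f' x - i (e' x).
  apply: linear_of => a x y.
  by rewrite (linearP f') (linearP e') (linearP i) scalerBr opprD addrACA.
have [|g gE] := @injective_extend _ _ _ (pr_diff Q k) h injI.
  move=> x /(@pr_exact _ _ Q k x).1[y <-]; rewrite hE.
  by have := eE y; rewrite e'E /= => ->; rewrite subrr.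
exists (p \o g) => x /=; rewrite -gE hE linearB /=.
have /ip -> : exists y, i y = i (e' x) by exists (e' x).
by rewrite subr0 f'E.
Qed.

End Resolutions.

Section InjectiveCoresolution.
Variables (R : pzRingType).
Implicit Type E : lmodType R.

(** [inj_hull E] is a chosen injective module containing [E]; no minimality is
    meant. *)
Definition inj_hull E : lmodType R := sval (cid (enough_injectives E)).
Definition inj_emb E : {linear E -> inj_hull E} :=
  sval (cid (svalP (cid (enough_injectives E)))).
Lemma inj_emb_inj E : injective (@inj_emb E).
Proof. by have [] := svalP (cid (svalP (cid (enough_injectives E)))). Qed.
Lemma inj_hull_injective E : injective_module (inj_hull E).
Proof. by case: (svalP (cid (svalP (cid (enough_injectives E))))). Qed.

Definition cosyz E : lmodType R := quot (img_sub (@inj_emb E)).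
Definition cosyz_proj E : {linear inj_hull E -> cosyz E} := qproj (img_sub (@inj_emb E)).
Lemma cosyz_proj_surj E : surjective (@cosyz_proj E).
Proof. exact: qproj_surj. Qed.
Lemma cosyz_exact E : exact_at (@inj_emb E) (@cosyz_proj E).
Proof. by move=> y; apply: qproj_ker. Qed.

Variable E : lmodType R.
(** The coresolution is augmented and starts with [E] itself in degree 0, so that a
    homotopy into it has its lowest component in [E]. *)
Fixpoint cosyz_iter n : lmodType R :=
  if n is n'.+1 then cosyz (cosyz_iter n') else E.
Definition cores n : lmodType R :=
  if n is n'.+1 then inj_hull (cosyz_iter n') else E.
Definition cores_diff n : {linear cores n -> cores n.+1} :=
  match n with
  | 0 => @inj_emb E
  | n'.+1 => @inj_emb (cosyz_iter n'.+1) \o @cosyz_proj (cosyz_iter n')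
  end.

Lemma cores_injective n : injective_module (cores n.+1).
Proof. exact: inj_hull_injective. Qed.

Lemma cores_exact n : exact_at (cores_diff n) (cores_diff n.+1).
Proof.
have ker m y : cores_diff m.+1 y = 0 <-> exists x, @inj_emb (cosyz_iter m) x = y.
  split=> [/= Ey|[x <-] /=].
    by apply/cosyz_exact/inj_emb_inj; rewrite Ey linear0.
  by rewrite (cosyz_exact _).2 ?linear0 //; exists x.
move=> y; split=> [/ker[x <-]|[x <-]]; last first.
  by apply/ker; case: n x {y} => [|n] x; [exists x|exists (cosyz_proj _ x)].
case: n x {y} => [|n] x; first by exists x.
by have [z <-] := cosyz_proj_surj x; exists z.
Qed.

Hypothesis sfiE : strongly_FP_injective E.

Lemma cosyz_iter_SFI n : strongly_FP_injective (cosyz_iter n).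
Proof.
elim: n => //= n IHn.
exact: (SFI_cosyzygy IHn (@inj_hull_injective _) (@inj_emb_inj _)
  (@cosyz_exact _) (@cosyz_proj_surj _)).
Qed.

(** A differential is a surjection onto a cosyzygy followed by an embedding, and
    the systems are solved in the cosyzygy. *)
Lemma cores_pure i m n (D : 'M[R]_(m, n)) (w : 'I_m -> cores i)
    (w' : 'I_n -> cores i.+1) :
  (forall p, cores_diff i (w p) = \sum_q D p q *: w' q) ->
  exists s : 'I_n -> cores i,
    forall p, cores_diff i (w p) = \sum_q D p q *: cores_diff i (s q).
Proof.
case: i w w' => [|i] w w' wE.
  have [s sE] := SFI_pure sfiE (@inj_emb_inj E) wE.
  exists s => p /=; rewrite [w p]sE linear_sum.
  by apply: eq_bigr => q _; rewrite linearZ.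
have [v vE] := SFI_pure (w := fun p => cosyz_proj _ (w p)) (@cosyz_iter_SFI i.+1)
  (@inj_emb_inj _) wE.
have [t tK] := boolp.choice (@cosyz_proj_surj (cosyz_iter i)).
exists (fun q => t (v q)) => p /=; rewrite [cosyz_proj _ (w p)]vE linear_sum.
by apply: eq_bigr => q _; rewrite linearZ /= tK.
Qed.

End InjectiveCoresolution.

(** * Null-homotopies into pure-exact complexes *)

Section NullHomotopy.
Variables (R : pzRingType) (J : nat -> lmodType R).
Variable del : forall i, {linear J i -> J i.+1}.
Hypothesis J_exact : forall i, exact_at (del i) (del i.+1).
Hypothesis J_pure : forall i m n (D : 'M[R]_(m, n)) (w : 'I_m -> J i)
    (w' : 'I_n -> J i.+1),
  (forall p, del i (w p) = \sum_q D p q *: w' q) ->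
  exists s : 'I_n -> J i,
    forall p, del i (w p) = \sum_q D p q *: del i (s q).

Let del_del i x : del i.+1 (del i x) = 0.
Proof. by apply/J_exact; exists x. Qed.

(** Maps out of finitely generated free modules are families [v] of elements, and
    differentials of the source are matrices [D].  The chain map is indexed so as to
    raise the degree by one, and then homotopies preserve it. *)
Section LocallyFinite.
Variables (n : nat -> nat) (D : forall i, 'M[R]_(n i, n i.+1)).
Variable v : forall i, 'I_(n i) -> J i.+1.
Hypothesis DD : forall i, D i *m D i.+1 = 0.
Hypothesis v_chain :
  forall i p, \sum_q D i p q *: v q = del i.+1 (v p).

Let DDE i (V : lmodType R) (z : 'I_(n i.+2) -> V) p :
  \sum_q D i p q *: (\sum_r D i.+1 q r *: z r) = 0.
Proof.
under eq_bigr do rewrite scaler_sumr.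
rewrite exchange_big big1 // => r _.
under eq_bigr do rewrite scalerA.
rewrite -scaler_suml.
have /matrixP/(_ p r) := DD i; rewrite !mxE => ->.
exact: scale0r.
Qed.

Lemma null_homotopy_finite :
  exists x : forall i, 'I_(n i) -> J i,
    forall i p, v p = \sum_q D i p q *: x i.+1 q + del i (x i p).
Proof.
have s_ex i : exists s : 'I_(n i.+1) -> J i.+1,
    forall p, del i.+1 (v p) = \sum_q D i p q *: del i.+1 (s q).
  by apply: (@J_pure i.+1 _ _ (D i) (@v i) (@v i.+1)) => p; rewrite v_chain.
(* By purity [s] makes [v - s D] vanish under [del]; this choice in degree [i]
   does not depend on the other degrees. *)
pose s i := if i is i'.+1 return 'I_(n i) -> J i then sval (cid (s_ex i'))
            else fun=> 0.
have sE i p : del i.+1 (v p) = \sum_q D i p q *: del i.+1 (s i.+1 q).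
  by rewrite /s /=; case: cid.
(* What is left once the homotopy [s] is subtracted: [y] is killed by [del], hence
   is [del e0], and also by [D]. *)
pose y i p := v p - \sum_q D i p q *: s i.+1 q - del i (s i p).
have y_ker i p : del i.+1 (y i p) = 0.
  rewrite /y !linearB /= del_del subr0 sE linear_sum -sumrB big1 // => q _.
  by rewrite linearZ /= subrr.
have y_chain i p : \sum_q D i p q *: y i.+1 q = 0.
  rewrite /y; under eq_bigr do rewrite !scalerBr.
  by rewrite !sumrB DDE subr0 v_chain sE subrr.
have e0_ex i p : exists z, del i z = y i p by apply/J_exact.
pose e0 i p := sval (cid (e0_ex i p)).
have e0E i p : del i (e0 i p) = y i p by rewrite /e0; case: cid.
(* Purity once more: the lift [e0] of [y] is corrected so that it is killed by [D],
   and adding it to [s] then leaves the equation in the previous degree intact. *)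
have e_ex i : exists e : 'I_(n i.+1) -> J i.+1,
    (forall q, del i.+1 (e q) = y i.+1 q) /\ forall p, \sum_q D i p q *: e q = 0.
  have [p|k kE] := @boolp.choice _ _
    (fun p z => del i z = \sum_q D i p q *: e0 i.+1 q).
    apply/J_exact; rewrite linear_sum -[RHS](y_chain i p).
    by apply: eq_bigr => q _; rewrite linearZ /= e0E.
  have [k' k'E] := J_pure kE.
  exists (fun q => e0 i.+1 q - del i (k' q)); split=> [q|p].
    by rewrite linearB /= del_del subr0 e0E.
  under eq_bigr do rewrite scalerBr.
  by rewrite sumrB -k'E kE subrr.
pose e i := if i is i'.+1 return 'I_(n i) -> J i then sval (cid (e_ex i'))
            else e0 0.
have eE i p : del i (e i p) = y i p.
  by case: i p => [|i] p; [apply: e0E|rewrite /e; case: cid => ? []].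
have eD i p : \sum_q D i p q *: e i.+1 q = 0 by rewrite /e; case: cid => ? [].
exists (fun i p => s i p + e i p) => i p.
under eq_bigr do rewrite scalerDr.
rewrite big_split /= eD addr0 linearD /= eE /y.
by rewrite -[v p - _ - _]addrA -opprD addrA addrC subrK.
Qed.

End LocallyFinite.

Variables (B : choiceType) (d : {linear free R B -> free R B}).
Hypothesis dd : forall x, d (d x) = 0.
Variable u : forall i, {linear free R B -> J i.+1}.
Hypothesis u_chain : forall i x, u i.+1 (d x) = del i.+1 (u i x).

Let Y (ib : nat * B) : Type := J ib.1.
Let lev (A : nat * B -> Prop) i : B -> Prop := fun b => A (i, b).
Let ext (x : forall ib, Y ib) i : {linear free R B -> J i} :=
  flin (fun b => x (i, b) : J i).

(** The domain is a set of pairs (degree, basis element) spanning a subcomplex. *)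
Definition partial_homotopy (s : pfun Y) : Prop :=
  forall i b, s.1 (i, b) ->
    supported (lev s.1 i.+1) (d (fgen b)) /\
    u i (fgen b) = ext s.2 i.+1 (d (fgen b)) + del i (s.2 (i, b)).

Lemma ext_eq (x x' : forall ib, Y ib) (A : nat * B -> Prop) i z :
  (forall b, A (i, b) -> x (i, b) = x' (i, b)) ->
  supported (lev A i) z -> ext x i z = ext x' i z.
Proof.
by move=> xx' Az; apply: eq_on_supported Az => b Ab; rewrite /ext !flin_gen xx'.
Qed.

Section Extend.
Variables (s : pfun Y) (sP : partial_homotopy s) (i0 : nat) (b0 : B).
Hypothesis nsb0 : ~ s.1 (i0, b0).
Let A := s.1.
Let x := s.2.

Let xA_supp i y : supported (lev A i) y -> supported (lev A i.+1) (d y).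
Proof.
move=> Ay; refine (@flin_mem R B _ (supported_sub (lev A i.+1)) d (lev A i) y _ Ay).
by move=> b Ab; have [] := sP Ab.
Qed.

Let xAE i y : supported (lev A i) y -> u i y = ext x i.+1 (d y) + del i (ext x i y).
Proof.
move: y; apply: supported_ind => [|a b y Ab IH]; first by rewrite !linear0 addr0.
rewrite !linearP /= {1}IH (sP Ab).2 /ext flin_gen.
by rewrite scalerDr addrACA.
Qed.

(** The closure of [b0], placed in degree [i0], under supports of differentials,
    minus what already lies in the domain [A].  It is finite in each degree: this
    is where a grading is needed although the source is the same in all degrees. *)
Fixpoint layer (i : nat) : seq B :=
  if i == i0 then [:: b0] else
  if i is i'.+1 then
    undup [seq c <- flatten [seq supp (d (fgen b)) | b <- layer i'] | ~~ `[< A (i, c) >]]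
  else [::].

Lemma layer_uniq i : uniq (layer i).
Proof. by case: i => [|i] /=; case: ifP => // _; apply: undup_uniq. Qed.

Lemma layer_disj i b : b \in layer i -> ~ A (i, b).
Proof.
case: i => [|i] /=; (case: eqP => [->|_]; first by rewrite inE => /eqP ->) => //.
by rewrite mem_undup mem_filter => /andP[/asboolP].
Qed.

Lemma layer_low i : (i < i0)%N -> layer i = [::].
Proof.
elim: i => [|i IHi] ii0 /=; first by case: eqP ii0 => // <-.
by rewrite ltn_eqF // IHi // ltnW.
Qed.

Lemma layer_i0 : b0 \in layer i0.
Proof.
suff H i : i = i0 -> b0 \in layer i by apply: H.
by case: i => [|i] E /=; rewrite E eqxx mem_head.
Qed.

Lemma layer_closed i b c : b \in layer i -> coef (d (fgen b)) c != 0 ->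
  ~ A (i.+1, c) -> c \in layer i.+1.
Proof.
move=> bi cb nAc /=; case: eqP => [ii0|_].
  by rewrite layer_low // -ii0 in bi.
rewrite mem_undup mem_filter; apply/andP; split; first exact/asboolP.
by apply/flattenP; exists (supp (d (fgen b))); [apply: map_f|rewrite mem_supp].
Qed.

Let n i := size (layer i).
Let el i (p : 'I_(n i)) : B := nth b0 (layer i) p.
Let el_mem i (p : 'I_(n i)) : el p \in layer i. Proof. exact: mem_nth. Qed.
Let D i : 'M[R]_(n i, n i.+1) := \matrix_(p, q) coef (d (fgen (el p))) (el q).
Let inA i : {linear free R B -> free R B} := restr (lev A i).
Let dS i (p : 'I_(n i)) := d (fgen (el p)) - inA i.+1 (d (fgen (el p))).

Let dSE i (p : 'I_(n i)) : dS p = \sum_q D i p q *: fgen (el q).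
Proof.
have H c : coef (dS p) c != 0 -> c \in layer i.+1.
  move=> cp; have nAc := @restr_compl _ _ (lev A i.+1) (d (fgen (el p))) c cp.
  apply: (layer_closed (el_mem p)) => //; move: cp.
  by rewrite coefB coef_restr; case: asboolP => // _; rewrite subr0.
rewrite (free_expand (layer_uniq i.+1) H) (big_nth b0) big_mkord.
apply: eq_bigr => q _; rewrite mxE coefB coef_restr.
by case: asboolP => [Aq|_]; [case: (layer_disj (el_mem q) Aq)|rewrite subr0].
Qed.

Let d_dS i (p : 'I_(n i)) : d (dS p) = - d (inA i.+1 (d (fgen (el p)))).
Proof. by rewrite linearB /= dd sub0r. Qed.

Let inA_supp i y : supported (lev A i) (inA i y).
Proof. exact: restr_supported. Qed.

Let DD i : D i *m D i.+1 = 0.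
Proof.
apply/matrixP => p r; rewrite !mxE.
transitivity (coef (d (dS p)) (el r)).
  rewrite dSE linear_sum coef_sum; apply: eq_bigr => q _.
  by rewrite linearZ coefZ [in RHS]mxE [D i.+1 q r]mxE mxE.
rewrite d_dS; apply/eqP/negPn/negP => h.
apply: (layer_disj (el_mem r)).
have : supported (lev A i.+2) (- d (inA i.+1 (d (fgen (el p))))).
  by apply: (smemN (S := supported_sub (lev A i.+2))); apply/xA_supp/inA_supp.
by apply.
Qed.

(* What the new values have to account for, once the known values on [A] have made
   their contribution. *)
Let v i (p : 'I_(n i)) : J i.+1 :=
  u i (fgen (el p)) - ext x i.+1 (inA i.+1 (d (fgen (el p)))).

Let v_chain i (p : 'I_(n i)) : \sum_q D i p q *: v q = del i.+1 (v p).
Proof.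
transitivity (u i.+1 (dS p) - ext x i.+2 (inA i.+2 (d (dS p)))).
  rewrite [in RHS]dSE (linear_sum (u i.+1)) (linear_sum d) (linear_sum (inA i.+2)).
  rewrite (linear_sum (ext x i.+2)) -sumrB; apply: eq_bigr => q _.
  by rewrite scalerBr !linearZ.
have yA := @inA_supp i.+1 (d (fgen (el p))).
rewrite d_dS [inA i.+2 _]linearN /= /inA (restr_id (xA_supp yA)).
rewrite linearN opprK linearB /= u_chain (xAE yA) /v linearB /=.
by rewrite opprD addrAC addrA addrK.
Qed.

Lemma partial_homotopy_extend : exists t, [/\ partial_homotopy t, pext s t & t.1 (i0, b0)].
Proof.
have [xi xiE] := null_homotopy_finite DD v_chain.
pose x' (ib : nat * B) : Y ib :=
  if `[< A ib >] then x ib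
  else if insub (index ib.2 (layer ib.1)) is Some p then xi ib.1 p else 0.
have x'A ib : A ib -> x' ib = x ib by rewrite /x'; case: asboolP.
have x'el i (p : 'I_(n i)) : x' (i, el p) = xi i p.
  rewrite /x'; case: asboolP => [/(layer_disj (el_mem p))//|_ /=].
  by rewrite index_uniq ?layer_uniq // valK.
pose A' (ib : nat * B) := A ib \/ ib.2 \in layer ib.1.
exists (A', x'); split; last by right; apply: layer_i0.
  have AA' i : forall b, lev A i b -> lev A' i b by move=> b; left.
  move=> i b [/= Ab|/= bi].
    have [Adb uE] := sP Ab; split; first exact: (supportedS (AA' _)) Adb.
    rewrite uE x'A //; congr (_ + _); apply: ext_eq Adb => c Ac.
    by rewrite x'A.
  have ind : (index b (layer i) < n i)%N by rewrite index_mem.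
  pose p := Ordinal ind; have bE : b = el p by rewrite /el nth_index.
  rewrite {}bE {bi}; split.
    move=> c dc; rewrite /lev /A' /=; case: (pselect (A (i.+1, c))) => [|nA]; first by left.
    by right; apply: layer_closed dc nA.
  have dE : d (fgen (el p)) = dS p + inA i.+1 (d (fgen (el p))) by rewrite subrK.
  rewrite x'el [in X in _ = X + _]dE linearD /= [in X in _ = X + _]dSE linear_sum /=.
  have -> : ext x' i.+1 (inA i.+1 (d (fgen (el p)))) =
            ext x i.+1 (inA i.+1 (d (fgen (el p)))).
    by apply: (@ext_eq _ _ A) => [c Ac|]; [rewrite x'A|apply: inA_supp].
  under eq_bigr => q _ do rewrite linearZ /= /ext flin_gen x'el.
  by rewrite addrAC -xiE subrK.
by split=> [ib|ib /x'A //]; left.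
Qed.

End Extend.

(** A maximal partial homotopy is total, as [partial_homotopy_extend] adds any
    missing basis element together with its locally finite closure. *)
Lemma null_homotopy :
  exists x : forall i, {linear free R B -> J i},
    forall i y, u i y = x i.+1 (d y) + del i (x i y).
Proof.
have [||m [mP _ mmax]] := @zorn_partial (nat * B) Y partial_homotopy (fun=> False, fun=> 0).
- by [].
- move=> C g [_ CP _] gE i b [s Cs sb] /=.
  have [sdb uE] := CP _ Cs _ _ sb.
  have sC j c : lev s.1 j c -> lev (punion C) j c by exists s.
  split; first exact: (supportedS (sC _)) sdb.
  rewrite uE (gE _ Cs _ sb); congr (_ + _); apply: ext_eq sdb => c sc.
  by apply/esym/(gE _ Cs).
have mT i b : m.1 (i, b).
  apply: contrapT => nb; have [t [tP mt tb]] := partial_homotopy_extend mP nb.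
  exact: nb (mmax _ tP mt _ tb).
exists (fun i => ext m.2 i) => i.
move=> y; have : supported (fun=> True) y by [].
move: y; apply: supported_ind => [|a b y _ IH]; first by rewrite !linear0 addr0.
rewrite !linearP /= {1}IH (mP _ _ (mT i b)).2 /ext flin_gen.
by rewrite scalerDr addrACA.
Qed.

End NullHomotopy.

(** * Homomorphisms from exact free differential modules *)

Lemma dependent_choice (T : nat -> Type) (Q : forall i, T i -> T i.+1 -> Prop) (x0 : T 0) :
  (forall i x, exists y, Q i x y) ->
  exists f : forall i, T i, f 0 = x0 /\ forall i, Q i (f i) (f i.+1).
Proof.
move=> step; pose nxt i x := sval (cid (step i x)).
exists (fun i => nat_rect T x0 nxt i); split=> // i /=.
by rewrite /nxt; case: cid.
Qed.

Section HomExact.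
Variables (R : pzRingType) (B : choiceType) (d : {linear free R B -> free R B}).
Hypothesis d_exact : exact_at d d.

Let dd x : d (d x) = 0. Proof. by apply/d_exact; exists x. Qed.

Definition hom_acyclic (N : lmodType R) : Prop :=
  forall g : {linear free R B -> N}, (forall x, g (d x) = 0) ->
  exists k : {linear free R B -> N}, forall x, g x = k (d x).

(** The extension of [g] to a chain map uses [ker d = im d] on the source and
    injectivity of the terms of the coresolution in positive degrees; the lowest
    component of the null-homotopy factors [g]. *)
Lemma SFI_hom_acyclic E : strongly_FP_injective E -> hom_acyclic E.
Proof.
move=> sfiE g gd.
pose T i := {f : {linear free R B -> cores E i.+1} |
               forall x, cores_diff E i.+1 (f (d x)) = 0}.
have [u0 u0E] : exists u0 : {linear free R B -> cores E 1},
    forall x, (cores_diff E 0 \o g) x = u0 (d x).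
  apply: (injective_extend (@cores_injective _ E 0)) => x /d_exact[y <-] /=.
  by rewrite gd linear0.
have u0d x : cores_diff E 1 (u0 (d x)) = 0.
  by rewrite -u0E; apply/cores_exact; exists (g x).
have [|u [u0' uE]] := @dependent_choice T
    (fun i f f' => forall x, sval f' (d x) = cores_diff E i.+1 (sval f x)) (exist _ u0 u0d).
  move=> i [f fd].
  have [|f' f'E] := @injective_extend _ _ _ _ d (cores_diff E i.+1 \o f)
                      (@cores_injective _ E i.+1).
    by move=> _ /d_exact[x <-]; apply: fd.
  have f'd x : cores_diff E i.+2 (f' (d x)) = 0.
    by rewrite -f'E; apply/cores_exact; exists (f x).
  by exists (exist _ f' f'd) => x; apply/esym/f'E.
have [x xE] := null_homotopy (@cores_exact _ E) (fun i m n => @cores_pure _ E sfiE i m n)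
  dd (u := fun i => sval (u i)) (fun i x => uE i x).
exists (x 0) => y; apply: (@inj_emb_inj _ E).
have := u0E y; rewrite /= => ->.
by have := xE 0 (d y); rewrite u0' /= dd linear0 add0r.
Qed.

(** Long exact sequence of the differential groups [Hom(F, N)], [Hom(F, E)] and
    [Hom(F, L)], which form a short exact sequence as [F] is free. *)
Lemma hom_acyclic_kernel (N E L : lmodType R) (i : {linear N -> E}) (p : {linear E -> L}) :
  injective i -> exact_at i p -> surjective p ->
  hom_acyclic E -> hom_acyclic L -> hom_acyclic N.
Proof.
move=> i_inj ip p_surj hE hL g gd.
have [|k kE] := hE (i \o g); first by move=> x /=; rewrite gd linear0.
have [|l lE] := hL (p \o k).
  by move=> x /=; rewrite -kE; apply/ip; exists (g x).
have [l' l'E] := @free_projective R B _ _ p l p_surj.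
have [h hhE] : exists h : {linear free R B -> E}, forall x, h x = k x - l' (d x).
  by apply: linear_of => a x y; rewrite (linearP k) (linearP d) (linearP l') scalerBr opprD addrACA.
have [|n nE] := factor_inj (f := h) i_inj.
  move=> x; apply/ip; rewrite hhE linearB /= -[p (l' _)]/((p \o l') _) -l'E.
  by have /= -> := lE x; rewrite subrr.
exists n => x; apply: i_inj; rewrite nE hhE dd linear0 subr0.
exact: kE.
Qed.

(** Induction on the length, cutting off the first term.  The length counts the
    nonzero terms, so that the base case is [N = 0]. *)
Lemma coresolution_hom_acyclic (X : lmodType R -> Prop) m :
  (forall E, X E -> hom_acyclic E) ->
  forall (N : lmodType R) (E : nat -> lmodType R) (eta : {linear N -> E 0%N})
    (dE : forall i, {linear E i -> E i.+1}),
  (forall i, (i < m)%N -> X (E i)) -> (forall i, (m <= i)%N -> forall x : E i, x = 0) ->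
  injective eta -> exact_at eta (dE 0%N) ->
  (forall i, exact_at (dE i) (dE i.+1)) -> hom_acyclic N.
Proof.
move=> XH; elim: m => [|m IHm] N E eta dE EX E0 eta_inj eta_ex dE_ex.
  move=> g _; exists g => x; apply: eta_inj.
  by rewrite (E0 0 isT (eta (g x))) (E0 0 isT (eta _)).
have [p [p_surj pE]] := image_factor (dE 0%N).
apply: (@hom_acyclic_kernel _ _ _ eta p) => //.
- move=> y; split=> [py|[x <-]].
    by apply/eta_ex; rewrite -pE py linear0.
  by apply: incl_inj; rewrite pE linear0; apply/eta_ex; exists x.
- exact/XH/EX.
apply: (IHm _ (fun i => E i.+1) incl (fun i => dE i.+1)).
- by move=> i im; apply: EX.
- by move=> i im; apply: E0.
- exact: incl_inj.
- move=> y; split=> [/dE_ex[x <-]|[z <-]].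
    by exists (p x); rewrite pE.
  by apply/dE_ex; have [x xE] := incl_mem z; exists x.
- by move=> i; apply: dE_ex.
Qed.

Lemma SFI_vee_hom_acyclic N : SFI_vee N -> hom_acyclic N.
Proof.
move=> [m [E [eta [dE [EX E0 eta_inj eta_ex dE_ex]]]]].
apply: (coresolution_hom_acyclic (m := m.+1) SFI_hom_acyclic _ _ eta_inj eta_ex dE_ex).
  by move=> i; apply: EX.
by move=> i; apply: E0.
Qed.

(** The complete resolution is constant, [F] with differential [d] in each degree. *)
Lemma cycles_Gorenstein_projective :
  (forall P : lmodType R, projective P -> SFI_vee P) ->
  Gorenstein_projective (subm (ker_sub d)).
Proof.
move=> hR; exists (fun=> free R B), (fun=> d); split=> //.
- by move=> _; apply: free_projective.
- move=> P projP _ h; split=> [hd|[k kE] x].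
    have [k kE] := SFI_vee_hom_acyclic (hR _ projP) hd.
    by exists k.
  by rewrite kE /= dd linear0.
- exists 0, incl; split; first exact: incl_inj.
  move=> y; split=> [|[x <-]]; last exact: (incl_mem x).
  exact: (@incl_surj _ _ (ker_sub d)).
Qed.

End HomExact.

(** * Acyclic sets of basis elements *)

Section AcyclicSets.
Variables (R : pzRingType) (B : choiceType) (d : {linear free R B -> free R B}).

Definition d_closed (A : B -> Prop) : Prop := forall b, A b -> supported A (d (fgen b)).
Definition acyclic_on (A : B -> Prop) : Prop :=
  forall z, supported A z -> d z = 0 -> exists2 w, supported A w & d w = z.

Lemma d_closedP A z : d_closed A -> supported A z -> supported A (d z).
Proof.
move=> dA Az; refine (@flin_mem R B _ (supported_sub A) d A z _ Az) => b Ab.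
exact: dA.
Qed.

Lemma supportedD (A : B -> Prop) (x y : free R B) :
  supported A x -> supported A y -> supported A (x + y).
Proof. exact: (@smemD _ _ (supported_sub A)). Qed.
Lemma supportedB (A : B -> Prop) (x y : free R B) :
  supported A x -> supported A y -> supported A (x - y).
Proof. exact: (@smemB _ _ (supported_sub A)). Qed.

(** Acyclicity of a subcomplex and of the quotient by it gives that of the whole;
    the last hypothesis is the acyclicity of the span of [A'] modulo that of [A]. *)
Lemma acyclic_extend (A A' : B -> Prop) :
  (forall b, A' b -> d (d (fgen b)) = 0) ->
  d_closed A -> acyclic_on A ->
  (forall z, supported A' z -> supported A (d z) ->
     exists2 w, supported A' w & supported A (z - d w)) ->
  acyclic_on (fun b => A b \/ A' b).
Proof.
move=> ddA' dA acA quo x Ax dx.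
pose xA := restr A x; pose z := x - xA.
have A'z : supported A' z.
  move=> b zb; have nAb : ~ A b := restr_compl zb.
  have : coef x b != 0.
    by move: zb; rewrite coefB coef_restr; case: asboolP => // _; rewrite subr0.
  by move=> /Ax[].
have AxA : supported A xA by apply: restr_supported.
have [|w A'w Aw] := quo z A'z.
  by rewrite linearB /= dx; apply: supportedB (d_closedP dA AxA); apply: (smem0 (supported_sub A)).
have ddw : d (d w) = 0.
  move: A'w; apply: (supported_ind (P := fun w => d (d w) = 0)); rewrite ?linear0 //.
  by move=> a b y A'b ddy; rewrite !linearP /= ddA' // ddy scaler0 addr0.
have [|w' Aw' w'E] := acA (z - d w + xA) (supportedD Aw AxA).
  by rewrite addrAC subrK linearB /= dx ddw subrr.
exists (w + w').
  by apply: supportedD; [move: A'w|move: Aw']; apply: supportedS => b; [right|left].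
by rewrite linearD /= w'E addrA [d w + _]addrC subrK subrK.
Qed.

End AcyclicSets.

(** * The differential module generated by all small extensions *)

(** Names for the elements of the closure of one basis element: [Child t k] is the
    [k]-th element in the support of the differential of [t], and [Fill l k] is
    the [k]-th element in the support of a chosen preimage of the cycle denoted by
    the formal sum [l].  A single type serves all differential modules over [R],
    which makes the blocks below form a type and not a proper class. *)
Inductive term (R : Type) : Type :=
  | Root | Child of term R & nat | Fill of seq (R * term R) & nat.
Arguments Root {R}.
HB.instance Definition _ (R : Type) := gen_eqMixin (term R).
HB.instance Definition _ (R : Type) := gen_choiceMixin (term R).

(** A block is a free differential module with basis a set of terms, together with
    the data that attach it to a differential module over [M]: [battach] sends
    each basis element to a formal sum of older cells, to be added to its
    differential, and [bvalue] sends it to [M].  The older cells are themselves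
    cells of blocks, hence the mutual recursion, and attaching goes on
    transfinitely without any ordinal. *)
Inductive cell (R : pzRingType) (M : lmodType R) : Type :=
  Cell of block M & term R
with block (R : pzRingType) (M : lmodType R) : Type :=
  Block of term R -> Prop & (term R -> free R (term R)) & (term R -> seq (R * cell M))
    & (term R -> M).


HB.instance Definition _ R M := gen_eqMixin (@cell R M).
HB.instance Definition _ R M := gen_choiceMixin (@cell R M).
HB.instance Definition _ R M := gen_eqMixin (@block R M).

Section Cells.
Variables (R : pzRingType) (M : lmodType R).
Notation T := (term R).
Notation cell := (cell M).
Notation block := (block M).
Implicit Types (x : cell) (k : block) (t : T).

Definition cblock x : block := let: Cell k _ := x in k.
Definition cterm x : T := let: Cell _ t := x in t.
Definition bsupp k : T -> Prop := let: Block s _ _ _ := k in s.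
Definition bdiff k : {linear free R T -> free R T} :=
  let: Block _ f _ _ := k in flin f.
Definition battach k : T -> seq (R * cell) := let: Block _ _ c _ := k in c.
Definition bvalue k : T -> M := let: Block _ _ _ g := k in g.

Definition bemb k : {linear free R T -> free R cell} := flin (fun t => fgen (Cell k t)).
Definition formal_sum (B : choiceType) (l : seq (R * B)) : free R B :=
  \sum_(p <- l) p.1 *: fgen p.2.

Definition cdiff : {linear free R cell -> free R cell} :=
  flin (fun x => let k := cblock x in
    bemb k (bdiff k (fgen (cterm x))) + formal_sum (battach k (cterm x))).
Definition cvalue : {linear free R cell -> M} :=
  flin (fun x => bvalue (cblock x) (cterm x)).

Lemma cdiff_gen k t :
  cdiff (fgen (Cell k t)) = bemb k (bdiff k (fgen t)) + formal_sum (battach k t).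
Proof. by rewrite /cdiff flin_gen. Qed.
Lemma cvalue_gen k t : cvalue (fgen (Cell k t)) = bvalue k t.
Proof. by rewrite /cvalue flin_gen. Qed.

Definition cells_of (D : block -> Prop) x : Prop :=
  D (cblock x) /\ bsupp (cblock x) (cterm x).

Definition acyclic_block k : Prop :=
  forall z, supported (bsupp k) z -> bdiff k z = 0 ->
  exists2 w, supported (bsupp k) w & bdiff k w = z.

(** Blocks that can be attached: their attaching maps hit legitimate cells, the
    total differential has square zero and is killed by the map to [M], and the
    block by itself is acyclic.  These conditions bear on all the blocks below [k],
    and hence are an inductive predicate. *)
Inductive good k : Prop := Good of
    (forall t p, bsupp k t -> p \in battach k t -> good (cblock p.2))
  & (forall t p, bsupp k t -> p \in battach k t -> bsupp (cblock p.2) (cterm p.2))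
  & (forall t, bsupp k t -> supported (bsupp k) (bdiff k (fgen t)))
  & (forall t, bsupp k t -> cdiff (cdiff (fgen (Cell k t))) = 0)
  & (forall t, bsupp k t -> cvalue (cdiff (fgen (Cell k t))) = 0)
  & acyclic_block k.

Lemma formal_sum_supported (B : choiceType) (A : B -> Prop) (l : seq (R * B)) :
  (forall p, p \in l -> A p.2) -> supported A (formal_sum l).
Proof.
move=> lA; rewrite /formal_sum big_seq.
elim/big_rec: _ => [|p y pl Ay]; first exact: (smem0 (supported_sub A)).
apply: supportedD => //; apply: (smemZ (S := supported_sub A)).
by apply: supported_gen; apply: lA.
Qed.

Let forget : {linear free R cell -> free R T} := flin (fun x => fgen (cterm x)).

Let forgetK k z : forget (bemb k z) = z.
Proof.
apply: (@eq_on_gen _ _ _ (forget \o bemb k) idfun) => t /=.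
by rewrite /bemb /forget !flin_gen.
Qed.

Let bemb_forget k y : supported (fun x => cblock x = k) y -> bemb k (forget y) = y.
Proof.
apply: (@eq_on_supported _ _ _ (bemb k \o forget) idfun) => -[k' t] /= ->.
by rewrite /bemb /forget !flin_gen.
Qed.

Lemma bemb_supported k z : supported (bsupp k) z ->
  supported (fun x => cblock x = k /\ bsupp k (cterm x)) (bemb k z).
Proof.
move=> kz; refine (@flin_mem _ _ _ (supported_sub _) (bemb k) _ z _ kz) => t kt.
by rewrite /bemb flin_gen; apply: supported_gen.
Qed.

Let forget_supported k y :
  supported (fun x => cblock x = k /\ bsupp k (cterm x)) y ->
  supported (bsupp k) (forget y).
Proof.
move=> ky; refine (@flin_mem _ _ _ (supported_sub _) forget _ y _ ky) => -[k' t] /= [_ kt].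
by rewrite /forget flin_gen; apply: supported_gen.
Qed.

Section GoodCells.
Let good_cell := cells_of good.

Lemma cdiff_closed_of (D : block -> Prop) :
  (forall k, D k -> good k) ->
  (forall k t p, D k -> bsupp k t -> p \in battach k t -> D (cblock p.2)) ->
  d_closed cdiff (cells_of D).
Proof.
move=> Dgood Dclosed [k t] [/= Dk kt]; rewrite cdiff_gen.
have [gk1 gk2 gk3 _ _ _] := Dgood _ Dk.
apply: supportedD.
  have := bemb_supported (gk3 _ kt).
  by apply: supportedS => x [xk kx]; rewrite /cells_of xk.
apply: formal_sum_supported => p pk; split; first exact: Dclosed pk.
exact: gk2 pk.
Qed.

Lemma good_closed : d_closed cdiff good_cell.
Proof.
refine (@cdiff_closed_of good (fun k gk => gk) _) => k t p gk kt pk.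
by case: gk => gk1 _ _ _ _ _; apply: gk1 kt pk.
Qed.

Lemma good_diff2 z : supported good_cell z -> cdiff (cdiff z) = 0.
Proof.
apply: (@eq_on_supported _ _ _ (cdiff \o cdiff) \0) => -[k t] [/= gk kt].
by case: gk => _ _ _ + _ _; apply.
Qed.

Lemma good_value z : supported good_cell z -> cvalue (cdiff z) = 0.
Proof.
apply: (@eq_on_supported _ _ _ (cvalue \o cdiff) \0) => -[k t] [/= gk kt].
by case: gk => _ _ _ _ + _; apply.
Qed.

Let Y (k : block) : Type := unit.
Let cell_set (s : pfun Y) : Prop :=
  [/\ forall k, s.1 k -> good k,
      forall k t p, s.1 k -> bsupp k t -> p \in battach k t -> s.1 (cblock p.2)
    & acyclic_on cdiff (cells_of s.1)].

(** A maximal set of blocks that is closed under attaching and has acyclic span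
    contains every good block, by induction on goodness: once the blocks to which
    [k] is attached belong to the set, so may [k], by [acyclic_extend]. *)
Lemma good_acyclic : acyclic_on cdiff good_cell.
Proof.
have [||m [[mgood mclosed mac] _ mmax]] := @zorn_partial _ Y cell_set (fun=> False, fun=> tt).
- split=> // z z0 _; exists 0; last first.
    by rewrite linear0 [z]supported0 // => b zb; case: (z0 b zb).
  exact: (smem0 (supported_sub _)).
- move=> C g CP _; have [[s0 Cs0] CcellP _] := CP.
  split=> [k [s Cs sk]|k t p [s Cs sk] kt pk|z zC dz] /=.
  + by have [sg _ _] := CcellP _ Cs; apply: sg.
  + by exists s => //; have [_ sc _] := CcellP _ Cs; apply: sc pk.
  have [k|s Cs sz] := pchain_seq (l := [seq cblock x | x <- supp z]) CP.
    case/mapP => x xz ->.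
    by have [] : cells_of (punion C) x by apply: (supported_supp zC).
  have [_ _ sac] := CcellP _ Cs.
  have [|w sw wz] := sac z _ dz.
    move=> x xz; have [_ kx] := zC x xz; split=> //.
    by apply/sz/map_f; rewrite mem_supp.
  by exists w => //; apply: supportedS sw => x [sx kx]; split=> //; exists s.
suff gm k : good k -> m.1 k.
  move=> z gz dz; have [|w mw wz] := mac z _ dz.
    by apply: supportedS gz => x [/gm mx kx].
  exists w; last exact: wz.
  by apply: supportedS mw => x [mx kx]; split; [apply: mgood|].
move=> gk; elim: {k} gk (gk) => k gk1 IH gk2 gk3 gk4 gk5 gk6 gk.
have [//|nmk] := pselect (m.1 k).
apply: (mmax (fun k' => m.1 k' \/ k' = k, fun=> tt)); last 1 first.
- by right.
- have catt t p : bsupp k t -> p \in battach k t -> m.1 (cblock p.2).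
    by move=> kt pk; apply: (IH _ _ kt pk); apply: gk1 pk.
  split=> [k' [/mgood|->]//|k' t p [mk'|->] /= kt pk|].
  + by left; apply: mclosed pk.
  + by left; apply: catt pk.
  have : acyclic_on cdiff (fun x => cells_of m.1 x \/ (cblock x = k /\ bsupp k (cterm x))).
    apply: acyclic_extend => //.
    * by move=> [k' t] [/= -> kt]; apply: gk4.
    * exact: cdiff_closed_of.
    move=> z kz mdz.
    pose z' := forget z; have kz' : supported (bsupp k) z' by apply: forget_supported.
    have zE : z = bemb k z'.
      by rewrite bemb_forget //; apply: supportedS kz => x [].
    (* The attaching part of the differential, which lands among older cells. *)
    pose att y := cdiff (bemb k y) - bemb k (bdiff k y).
    have attP y : supported (bsupp k) y -> supported (cells_of m.1) (att y).
      apply: (supported_ind (P := fun y => supported (cells_of m.1) (att y))) => [|a t w kt IHw].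
        rewrite /att (linear0 (bdiff k)) (linear0 (bemb k)) (linear0 cdiff) subrr.
        exact: (smem0 (supported_sub _)).
      have -> : att (a *: fgen t + w) = a *: formal_sum (battach k t) + att w.
        rewrite /att (linearP (bemb k)) (linearP cdiff) (linearP (bdiff k)).
        rewrite (linearP (bemb k)) {1}/bemb flin_gen cdiff_gen scalerDr opprD.
        by rewrite addrACA; congr (_ + _); rewrite addrAC subrr add0r.
      apply: (smemP (s := supported_sub _)) => //.
      apply: formal_sum_supported => p pk; split; first exact: catt pk.
      exact: gk2 pk.
    have dz'0 : bdiff k z' = 0.
      rewrite -[LHS](forgetK k).
      suff -> : bemb k (bdiff k z') = 0 by rewrite linear0.
      have mbz : supported (cells_of m.1) (bemb k (bdiff k z')).
        have -> : bemb k (bdiff k z') = cdiff z - att z' by rewrite /att zE opprB addrC subrK.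
        exact: supportedB mdz (attP _ kz').
      apply: supported0 => x xb; have [mx _] := mbz x xb.
      have kdz : supported (bsupp k) (bdiff k z').
        by refine (@flin_mem _ _ _ (supported_sub _) (bdiff k) _ z' _ kz') => t; apply: gk3.
      by have [xk _] := bemb_supported kdz xb; rewrite xk in mx.
    have [w kw wE] := gk6 z' kz' dz'0.
    exists (bemb k w); first exact: bemb_supported.
    have -> : z - cdiff (bemb k w) = - att w by rewrite /att wE -zE opprB.
    exact/(smemN (S := supported_sub _))/attP.
  move=> ac z zs dz; have [|w ws wz] := ac z _ dz.
    by apply: supportedS zs => x [[mx|xk] kx]; [left|right; split; rewrite -?xk].
  exists w; last exact: wz.
  apply: supportedS ws => x [[mx kx]|[xk kx]].
    by split; [left|exact: kx].
  by split; [right|rewrite xk].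
- by split=> k' mk' /=; [left|case: (m.2 k')].
Qed.

End GoodCells.
End Cells.

(** * Mapping exact free differential modules into the generated one *)

Section Lifting.
Variables (R : pzRingType) (M : lmodType R) (B : choiceType).
Variables (d : {linear free R B -> free R B}) (f : {linear free R B -> M}).
Hypothesis d_exact : exact_at d d.
Hypothesis fd : forall x, f (d x) = 0.

Notation T := (term R).
Notation cell := (cell M).
Notation cdiff := (@cdiff R M).
Notation cvalue := (@cvalue R M).
Notation good_cell := (cells_of (@good R M)).

Let dd x : d (d x) = 0. Proof. by apply/d_exact; exists x. Qed.

Let Y (b : B) : Type := free R cell.

Definition partial_lift (s : pfun Y) : Prop :=
  [/\ d_closed d s.1, acyclic_on d s.1
    & forall b, s.1 b ->
        [/\ supported good_cell (s.2 b), flin s.2 (d (fgen b)) = cdiff (s.2 b)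
          & cvalue (s.2 b) = f (fgen b)]].

Section Extend.
Variables (s : pfun Y) (sP : partial_lift s) (b0 : B).
Hypothesis nsb0 : ~ s.1 b0.
Let A := s.1.
Let h := s.2.
Let nA b := ~ A b.

Let dA : d_closed d A. Proof. by case: sP. Qed.
Let acA : acyclic_on d A. Proof. by case: sP. Qed.

(* Two out of three: [F] and the span of [A] are exact, hence so is the quotient. *)
Let quotient_exact z : supported nA z -> supported A (d z) ->
  exists2 w, supported nA w & supported A (z - d w).
Proof.
move=> nAz Adz; have [|w' Aw' w'E] := acA Adz; first exact: dd.
have [v vE] : exists v, d v = z - w'.
  by apply/d_exact; rewrite linearB /= w'E subrr.
exists (v - restr A v); first exact: restr_compl.
have -> : z - d (v - restr A v) = w' + d (restr A v).
  rewrite linearB /= vE; apply/eqP.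
  by rewrite subr_eq -[z - w' - d _]addrA -opprD [X in _ == X]addrC subrK.
apply: (supportedD Aw'); apply: (d_closedP dA); exact: restr_supported.
Qed.

Let W_ex z : exists w, supported nA w /\
  (supported nA z -> supported A (d z) -> supported A (z - d w)).
Proof.
have [[nAz Adz]|nP] := pselect (supported nA z /\ supported A (d z)).
  by have [w nAw Aw] := quotient_exact nAz Adz; exists w.
exists 0; split=> [|nAz Adz]; first exact: (smem0 (supported_sub nA)).
by case: nP.
Qed.
Let W z := sval (cid (W_ex z)).
Let W_supp z : supported nA (W z). Proof. by rewrite /W; case: cid => w []. Qed.
Let WE z : supported nA z -> supported A (d z) -> supported A (z - d (W z)).
Proof. by rewrite /W; case: cid => w []. Qed.

Let pd x := d x - restr A (d x).

(** The closure of [b0] in the quotient by [A], as the image of [term R].  The default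
    [b0] of [nth] is harmless since [b0] belongs to the closure. *)
Fixpoint teval (t : T) : B :=
  match t with
  | Root => b0
  | Child t' k => nth b0 (supp (pd (fgen (teval t')))) k
  | Fill l k =>
      nth b0 (supp (W (formal_sum [seq (p.1, teval p.2) | p <- l]))) k
  end.
Let A' b := exists t, teval t = b.

Let sg_ex : exists sg : B -> T, forall b, A' b -> teval (sg b) = b.
Proof.
have [|sg sgE] := @boolp.choice B T (fun b t => A' b -> teval t = b).
  move=> b; have [[t tb]|nb] := pselect (A' b); first by exists t.
  by exists Root => /nb.
by exists sg.
Qed.
Let sg := sval (cid sg_ex).
Let sgE b : A' b -> teval (sg b) = b.
Proof. by rewrite /sg; case: cid => g gE /=; apply: gE. Qed.

Let A'nA b : A' b -> nA b.
Proof.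
have nth_supp x k : supported nA x -> nA (nth b0 (supp x) k).
  move=> nAx; have [kx|kx] := ltnP k (size (supp x)); last by rewrite nth_default.
  exact: supported_supp nAx _ (mem_nth _ kx).
case=> t <-; case: t => //= [t k|l k]; apply: nth_supp.
  exact: restr_compl.
exact: W_supp.
Qed.

Let pd_supp x : supported A' x -> supported A' (pd x).
Proof.
apply: (supported_ind (P := fun x => supported A' (pd x))) => [|a b y [t <-] IH].
  rewrite /pd (linear0 d) (linear0 (restr A)) subrr; exact: (smem0 (supported_sub _)).
rewrite /pd (linearP d) (linearP (restr A)) opprD addrACA -scalerBr.
apply: supportedP IH => c; rewrite -mem_supp => cs.
by exists (Child t (index c (supp (pd (fgen (teval t)))))) => /=; rewrite nth_index.
Qed.

Let W_term z : supported A' z -> supported A' (W z).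
Proof.
move=> A'z; have A'nAz : supported nA z by apply: supportedS A'z.
pose l := [seq (coef z b, sg b) | b <- supp z].
have lE : formal_sum [seq (p.1, teval p.2) | p <- l] = z.
  rewrite [RHS]free_sum_supp /formal_sum /l !big_map !big_seq.
  by apply: eq_bigr => b bz /=; rewrite sgE //; apply: supported_supp bz.
move=> c; rewrite -mem_supp => cs.
by exists (Fill l (index c (supp (W z)))) => /=; rewrite lE nth_index.
Qed.

Let A'_quotient z : supported A' z -> supported A (d z) ->
  exists2 w, supported A' w & supported A (z - d w).
Proof.
move=> A'z Adz; exists (W z); first exact: W_term.
by apply: WE => //; apply: supportedS A'z.
Qed.

Let AA' b := A b \/ A' b.

Let d_closedAA' : d_closed d AA'.
Proof.
move=> b [Ab|A'b]; first by apply: supportedS (dA Ab) => c; left.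
rewrite -[d _](subrK (restr A (d (fgen b)))); apply: supportedD.
  have := pd_supp (supported_gen A'b); apply: supportedS => c; by right.
by have := @restr_supported _ _ A (d (fgen b)); apply: supportedS => c; left.
Qed.

Let acyclicAA' : acyclic_on d AA'.
Proof. exact: acyclic_extend. Qed.

Let toT : {linear free R B -> free R T} := flin (fun b => fgen (sg b)).
Let toB : {linear free R T -> free R B} := flin (fun t => fgen (teval t)).

Let attached t := flin h (restr A (d (fgen (teval t)))).
(* The closure [A'] as a block.  Several terms may denote the same basis element, so
   its basis is the set of the chosen terms [sg b], and it is attached along the
   images under [h] of the [A]-parts of the differentials. *)
Let newblock : block M :=
  Block (fun t => sg (teval t) = t)
    (fun t => toT (pd (fgen (teval t))))
    (fun t => [seq (coef (attached t) x, x) | x <- supp (attached t)])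
    (fun t => f (fgen (teval t))).
Let S := bsupp newblock.
Let bd := bdiff newblock.

Let h' b : free R cell :=
  if `[< A b >] then h b else fgen (Cell newblock (sg b)).
Let H : {linear free R B -> free R cell} := flin h'.

Let H_A x : supported A x -> H x = flin h x.
Proof.
apply: (@eq_on_supported _ _ _ H (flin h)) => b Ab.
by rewrite /H !flin_gen /h'; case: asboolP.
Qed.
Let H_A' x : supported A' x -> H x = bemb newblock (toT x).
Proof.
apply: (@eq_on_supported _ _ _ H (bemb newblock \o toT)) => b A'b /=.
rewrite /H flin_gen /h' /toT flin_gen /bemb flin_gen.
by case: asboolP => // Ab; case: (A'nA A'b).
Qed.

Let toB_toT x : supported A' x -> toB (toT x) = x.
Proof.
apply: (@eq_on_supported _ _ _ (toB \o toT) idfun) => b A'b /=.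
by rewrite /toT flin_gen /toB flin_gen sgE.
Qed.
Let toT_toB z : supported S z -> toT (toB z) = z.
Proof.
apply: (@eq_on_supported _ _ _ (toT \o toB) idfun) => t St /=.
by rewrite /toB flin_gen /toT flin_gen St.
Qed.
Let toB_supp z : supported A' (toB z).
Proof.
have : supported (fun=> True) z by [].
move=> zT; refine (@flin_mem _ _ _ (supported_sub A') toB _ z _ zT) => t _.
by rewrite /toB flin_gen; apply: supported_gen; exists t.
Qed.
Let toT_supp x : supported A' x -> supported S (toT x).
Proof.
move=> A'x; refine (@flin_mem _ _ _ (supported_sub S) toT _ x _ A'x) => b A'b.
by rewrite /toT flin_gen; apply: supported_gen; rewrite /S /= sgE.
Qed.

Let pd_linear : exists g : {linear free R B -> free R B}, forall x, g x = pd x.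
Proof.
apply: linear_of => a x y; rewrite /pd (linearP d) (linearP (restr A)).
by rewrite scalerBr opprD addrACA.
Qed.

Let bdE z : bd z = toT (pd (toB z)).
Proof.
have [g gE] := pd_linear.
rewrite -gE; apply: (@eq_on_gen _ _ _ bd (toT \o g \o toB)) => t.
by rewrite [bd _]flin_gen /= /toB flin_gen gE.
Qed.

Let H_chain b : AA' b -> cdiff (H (fgen b)) = H (d (fgen b)).
Proof.
move=> [Ab|A'b].
  rewrite /H flin_gen /h'; case: asboolP => // _; rewrite -/H H_A; last exact: dA.
  by have [_ _ /(_ _ Ab)[]] := sP.
rewrite H_A' ?[toT _]flin_gen ?[bemb _ _]flin_gen; last exact: supported_gen.
rewrite cdiff_gen -/bd bdE /toB flin_gen sgE // -H_A'; last first.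
  by apply: pd_supp; apply: supported_gen.
rewrite /formal_sum big_map /= -free_sum_supp /attached sgE // -H_A.
  by rewrite -linearD subrK.
exact: restr_supported.
Qed.

Let H_chainP x : supported AA' x -> cdiff (H x) = H (d x).
Proof. exact: (@eq_on_supported _ _ _ (cdiff \o H) (H \o d)). Qed.

Let H_value x : supported AA' x -> cvalue (H x) = f x.
Proof.
apply: (@eq_on_supported _ _ _ (cvalue \o H) f) => b [Ab|A'b] /=.
  rewrite H_A ?flin_gen; last exact: supported_gen.
  by have [_ _ /(_ _ Ab)[]] := sP.
rewrite H_A' ?[toT _]flin_gen ?[bemb _ _]flin_gen; last exact: supported_gen.
by rewrite cvalue_gen /= sgE.
Qed.

Let S_gen t : S t -> [/\ A' (teval t) & fgen (Cell newblock t) = H (fgen (teval t))].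
Proof.
move=> St; have A't : A' (teval t) by exists t.
split=> //; rewrite H_A' ?[toT _]flin_gen ?[bemb _ _]flin_gen ?St //.
exact: supported_gen.
Qed.

Let attached_good t : supported good_cell (attached t).
Proof.
have rA := @restr_supported _ _ A (d (fgen (teval t))).
refine (@flin_mem _ _ _ (supported_sub good_cell) (flin h) A _ _ rA) => b Ab.
by rewrite flin_gen; have [_ _ /(_ _ Ab)[]] := sP.
Qed.

Let newblock_good : good newblock.
Proof.
split.
- move=> t p _ /mapP[x xs ->] /=.
  by have [] := supported_supp (@attached_good t) xs.
- move=> t p _ /mapP[x xs ->] /=.
  by have [] := supported_supp (@attached_good t) xs.
- by move=> t _; rewrite -/bd bdE; apply/toT_supp/pd_supp.
- move=> t /S_gen[A't ->]; have AA't : AA' (teval t) by right.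
  by rewrite H_chain // H_chainP ?dd ?linear0 //; apply: d_closedAA'.
- move=> t /S_gen[A't ->]; have AA't : AA' (teval t) by right.
  by rewrite H_chain // H_value ?fd //; apply: d_closedAA'.
move=> z Sz; rewrite -/bd bdE => bz.
have pdz : pd (toB z) = 0.
  by rewrite -[pd _]toB_toT ?bz ?linear0 //; apply: pd_supp.
have [|w A'w Aw] := @A'_quotient (toB z) (@toB_supp z).
  by rewrite -[d _](subrK (restr A (d (toB z)))) -/(pd _) pdz add0r; apply: restr_supported.
exists (toT w); first exact: toT_supp.
rewrite -/bd bdE toB_toT // -[RHS]toT_toB //; congr (toT _).
apply/eqP; rewrite -subr_eq0; apply/eqP.
have zw : restr A (toB z - d w) = toB z - d w by apply: restr_id.
have rz : restr A (toB z) = 0.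
  by apply: restr_eq0; apply: supportedS (@toB_supp z) => b; apply: A'nA.
move: zw; rewrite linearB /= rz sub0r => /eqP; rewrite -subr_eq0 => /eqP zw.
by rewrite /pd -[RHS]zw opprB addrA [- restr A _ + _]addrC.
Qed.

(** The new values are the cells of [newblock]: goodness of that block is what makes
    them available. *)
Lemma partial_lift_extend : exists t, [/\ partial_lift t, pext s t & t.1 b0].
Proof.
exists (AA', h'); split; last by right; exists Root.
  split; [exact: d_closedAA'|exact: acyclicAA'|move=> b AA'b /=].
  have HE : H (fgen b) = h' b by rewrite /H flin_gen.
  split; rewrite -?HE; last 2 first.
  - by rewrite -(H_chain AA'b).
  - by rewrite H_value //; apply: supported_gen.
  rewrite HE /h'; case: asboolP => [Ab|nAb].
    by have [_ _ /(_ _ Ab)[]] := sP.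
  case: AA'b => [/nAb[]|A'b]; apply: supported_gen; split=> /=; first exact: newblock_good.
  by rewrite sgE.
split=> [b Ab|b Ab] /=; first by left.
by rewrite /h'; case: asboolP.
Qed.

End Extend.

Lemma chain_lift : exists h : {linear free R B -> free R cell},
  forall x, [/\ supported good_cell (h x), h (d x) = cdiff (h x) & cvalue (h x) = f x].
Proof.
have [||m [mP _ mmax]] := @zorn_partial B Y partial_lift (fun=> False, fun=> 0).
- split=> // z z0 _; exists 0; first exact: (smem0 (supported_sub _)).
  by rewrite linear0 [z]supported0.
- move=> C g CP gE; have [_ ClP _] := CP.
  have sC t b : C t -> t.1 b -> punion C b by move=> Ct tb; exists t.
  split=> [b [t Ct tb]|z zC dz|b [t Ct tb]] /=.
  + by have [tc _ _] := ClP _ Ct; apply: supportedS (tc _ tb) => c; apply: sC.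
  + have [b bz|t Ct tz] := pchain_seq (l := supp z) CP.
      exact: supported_supp zC b bz.
    have [_ tac _] := ClP _ Ct; have [|w tw wz] := tac z _ dz.
      by move=> b; rewrite -mem_supp => /tz.
    by exists w => //; apply: supportedS tw => c; apply: sC.
  have [tc _ /(_ _ tb)[tg tch tv]] := ClP _ Ct.
  rewrite (gE _ Ct _ tb); split=> //; rewrite -tch.
  apply: (@eq_on_supported _ _ _ (flin g) (flin t.2) t.1 _ _ (tc _ tb)) => c tcc.
  by rewrite !flin_gen (gE _ Ct).
have mT b : m.1 b.
  apply: contrapT => nb; have [t [tP mt tb]] := partial_lift_extend mP nb.
  exact: nb (mmax _ tP mt _ tb).
have [_ _ mE] := mP.
exists (flin m.2) => x; have xm : supported m.1 x by move=> b _; apply: mT.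
split.
- refine (@flin_mem _ _ _ (supported_sub good_cell) (flin m.2) m.1 x _ xm) => b mb.
  by rewrite flin_gen; have [] := mE _ mb.
- move: xm; apply: (@eq_on_supported _ _ _ (flin m.2 \o d) (cdiff \o flin m.2)) => b mb /=.
  by rewrite [in RHS]flin_gen; have [] := mE _ mb.
- move: xm; apply: (@eq_on_supported _ _ _ (cvalue \o flin m.2) f) => b mb /=.
  by rewrite flin_gen; have [] := mE _ mb.
Qed.

End Lifting.

(** * The universal exact free differential module over M *)

(** Exactness on the span of [A] becomes exactness of a whole free module, which is
    what complete resolutions consist of. *)
Lemma restrict_differential (R : pzRingType) (B : choiceType)
    (d : {linear free R B -> free R B}) (A : B -> Prop) :
  d_closed d A -> acyclic_on d A -> (forall z, supported A z -> d (d z) = 0) ->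
  exists (C : choiceType) (D : {linear free R C -> free R C})
    (e : {linear free R C -> free R B}),
  [/\ exact_at D D, injective e,
      forall y, supported A y -> exists z, e z = y,
      forall z, supported A (e z) & forall z, e (D z) = d (e z)].
Proof.
move=> dA acA ddA.
pose C := {b : B | `[< A b >]} : choiceType.
pose e : {linear free R C -> free R B} := flin (fun c : C => fgen (val c)).
pose r : {linear free R B -> free R C} :=
  flin (fun b : B => if insub b is Some c then fgen (c : C) else 0).
have eA z : supported A (e z).
  have zT : supported (fun=> True) z by [].
  refine (@flin_mem _ _ _ (supported_sub A) e _ z _ zT) => c _.
  by rewrite /e flin_gen; apply: supported_gen; apply/asboolP/(valP c).
have re z : r (e z) = z.
  apply: (@eq_on_gen _ _ _ (r \o e) idfun) => c /=.
  by rewrite /e flin_gen /r flin_gen valK.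
have er y : supported A y -> e (r y) = y.
  apply: (@eq_on_supported _ _ _ (e \o r) idfun) => b Ab /=.
  rewrite /r flin_gen; case: insubP => [c _ cb|/asboolP//].
  by rewrite /e flin_gen cb.
pose D : {linear free R C -> free R C} := r \o d \o e.
have eD z : e (D z) = d (e z) by rewrite /D /= er //; apply: d_closedP dA _.
have e_inj : injective e by apply: can_inj re.
exists C, D, e; split=> //; last by move=> y /er ry; exists (r y).
move=> z; split=> [Dz|[w <-]].
  have [|w Aw wz] := acA (e z) (eA z); first by rewrite -eD Dz linear0.
  by exists (r w); apply: e_inj; rewrite eD er.
by apply: e_inj; rewrite !eD ddA ?linear0.
Qed.

Lemma universal_differential (R : pzRingType) (M : lmodType R) :
  exists (C : choiceType) (D : {linear free R C -> free R C})
    (phi : {linear free R C -> M}),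
  [/\ exact_at D D, forall x, phi (D x) = 0
    & forall (B : choiceType) (d : {linear free R B -> free R B})
        (f : {linear free R B -> M}),
      exact_at d d -> (forall x, f (d x) = 0) ->
      exists h : {linear free R B -> free R C},
        forall x, h (d x) = D (h x) /\ phi (h x) = f x].
Proof.
have [C [D [e [Dex e_inj e_surj eA eD]]]] := restrict_differential
  (@good_closed R M) (@good_acyclic R M) (@good_diff2 R M).
exists C, D, (@cvalue R M \o e); split=> [//|x|B d f dex fd].
  by rewrite /= eD; apply: good_value.
have [h hE] := chain_lift dex fd.
have [|k kE] := factor_inj (f := h) e_inj.
  by move=> x; apply: e_surj; have [] := hE x.
exists k => x; have [_ hd hf] := hE x; split; last by rewrite /= kE.
by apply: e_inj; rewrite eD !kE.
Qed.

(** * From projective to free differential modules *)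

(** A projective differential module [P] is given as the image of an idempotent [e] of
    a free module [L], with its differential read as an endomorphism [q] of [L].
    With [Q] the image of [1 - e], both [P + Q + L + L + ...] and [L + L + ...] are
    free.  The former is [P + N] with [N = Q + L + L + ...], and [N] is isomorphic to
    [L + L + ...] by shifting the summands [P]: the [n]-th copy of [L] goes to the
    summand [Q] of the [n]-th place and to the summand [P] of the next one.  So [P]
    plus the cone of this isomorphism is free and exact.  In [swindle_basis] the
    boolean is [true] for the source [L + L + ...] of the isomorphism. *)
Section Swindle.
Variables (R : pzRingType) (B : choiceType) (e q : {linear free R B -> free R B}).
Hypothesis ee : forall x, e (e x) = e x.
Hypothesis e_q : forall x, e (q x) = q x.
Hypothesis qe : forall x, q (e x) = q x.
Hypothesis qq : forall x, q (q x) = 0.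
Hypothesis q_exact : forall x, q x = 0 -> exists y, e x = q y.

Definition swindle_basis : choiceType := (B * nat * bool)%type.
Notation X := (free R swindle_basis).

Definition swindle_in (n : nat) (s : bool) : {linear free R B -> X} :=
  flin (fun b => fgen (b, n, s)).
Definition swindle_pr (n : nat) (s : bool) : {linear X -> free R B} :=
  flin (fun x : swindle_basis =>
    if (x.1.2 == n) && (x.2 == s) then fgen x.1.1 else 0).

Lemma swindle_pr_in m t n s x : swindle_pr n s (swindle_in m t x) = if (m == n) && (t == s) then x else 0.
Proof.
case E : ((m == n) && (t == s)).
  apply: (@eq_on_gen _ _ _ (swindle_pr n s \o swindle_in m t) idfun) => b /=.
  by rewrite /swindle_in flin_gen /swindle_pr flin_gen /= E.
apply: (@eq_on_gen _ _ _ (swindle_pr n s \o swindle_in m t) \0) => b /=.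
by rewrite /swindle_in flin_gen /swindle_pr flin_gen /= E.
Qed.

Lemma swindle_ext x y : (forall n s, swindle_pr n s x = swindle_pr n s y) -> x = y.
Proof.
move=> xy; apply: coefP => -[[b n] s].
have H z : coef (swindle_pr n s z) b = coef z (b, n, s).
  rewrite [in LHS](free_sum_supp z) [in RHS](free_sum_supp z) linear_sum !coef_sum.
  apply: eq_bigr => -[[c m] t] _; rewrite linearZ !coefZ /swindle_pr flin_gen /= coef_gen.
  rewrite !xpair_eqE [n == m]eq_sym [s == t]eq_sym -andbA.
  by case: ((m == n) && (t == s)); rewrite ?andbT ?andbF ?coef_gen ?coef0.
by rewrite -!H xy.
Qed.

Lemma compl_ex : exists c : {linear free R B -> free R B}, forall x, c x = x - e x.
Proof. by apply: linear_of => a x y; rewrite linearP scalerBr opprD addrACA. Qed.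
Definition compl := sval (cid compl_ex).
Lemma complE x : compl x = x - e x. Proof. by rewrite /compl; case: cid. Qed.
Lemma compl_compl x : compl (compl x) = compl x.
Proof. by rewrite [LHS]complE complE linearB /= ee subrr subr0. Qed.
Lemma compl_e x : compl (e x) = 0. Proof. by rewrite complE ee subrr. Qed.
Lemma e_compl x : e (compl x) = 0. Proof. by rewrite complE linearB /= ee subrr. Qed.
Lemma q_compl x : q (compl x) = 0. Proof. by rewrite complE linearB /= qe subrr. Qed.

Definition swindle_diff : {linear X -> X} := flin (fun x : swindle_basis =>
  let: (b, n, s) := x in
  if s then swindle_in n false (compl (fgen b)) + swindle_in n.+1 false (e (fgen b))
  else if n is 0 then swindle_in 0 false (q (fgen b)) else 0).

(** The inverse of the isomorphism, which contracts the cone. *)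
Definition swindle_htpy : {linear X -> X} := flin (fun x : swindle_basis =>
  let: (b, n, s) := x in
  if s then 0 else
  swindle_in n true (compl (fgen b)) + (if n is m.+1 then swindle_in m true (e (fgen b)) else 0)).

Lemma swindle_diff_true n x : swindle_pr n true (swindle_diff x) = 0.
Proof.
apply: (@eq_on_gen _ _ _ (swindle_pr n true \o swindle_diff) \0) => -[[b m] s] /=.
rewrite /swindle_diff flin_gen; case: s => /=.
  by rewrite linearD /= !swindle_pr_in !andbF addr0.
by case: m => [|m]; rewrite ?linear0 ?swindle_pr_in ?andbF.
Qed.

Lemma swindle_diff0 x :
  swindle_pr 0 false (swindle_diff x) = q (swindle_pr 0 false x) + compl (swindle_pr 0 true x).
Proof.
apply: (@eq_on_gen _ _ _ (swindle_pr 0 false \o swindle_diff)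
  ((q \o swindle_pr 0 false) \+ (compl \o swindle_pr 0 true))) => -[[b m] s] /=.
rewrite /swindle_diff flin_gen ![swindle_pr _ _ (fgen _)]flin_gen /=; case: s => /=.
  rewrite andbF linear0 add0r linearD /= !swindle_pr_in /= addr0 !andbT.
  by case: eqP => _; rewrite ?linear0.
rewrite andbF linear0 addr0 andbT.
by case: m => [|m]; rewrite ?linear0 ?swindle_pr_in.
Qed.

Lemma swindle_diffS n x : swindle_pr n.+1 false (swindle_diff x) =
  compl (swindle_pr n.+1 true x) + e (swindle_pr n true x).
Proof.
apply: (@eq_on_gen _ _ _ (swindle_pr n.+1 false \o swindle_diff)
  ((compl \o swindle_pr n.+1 true) \+ (e \o swindle_pr n true))) => -[[b m] s] /=.
rewrite /swindle_diff flin_gen ![swindle_pr _ _ (fgen _)]flin_gen /=; case: s => /=.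
  rewrite linearD /= !swindle_pr_in !andbT eqSS.
  by congr (_ + _); case: eqP => _; rewrite ?linear0.
rewrite !andbF !linear0 addr0.
by case: m => [|m]; rewrite ?linear0 ?swindle_pr_in.
Qed.

Lemma swindle_htpy_false n x : swindle_pr n false (swindle_htpy x) = 0.
Proof.
apply: (@eq_on_gen _ _ _ (swindle_pr n false \o swindle_htpy) \0) => -[[b m] s] /=.
rewrite /swindle_htpy flin_gen; case: s => /=; first by rewrite linear0.
rewrite linearD /= swindle_pr_in andbF add0r.
by case: m => [|m]; rewrite ?linear0 ?swindle_pr_in ?andbF.
Qed.

Lemma swindle_htpy_true n x : swindle_pr n true (swindle_htpy x) =
  compl (swindle_pr n false x) + e (swindle_pr n.+1 false x).
Proof.
apply: (@eq_on_gen _ _ _ (swindle_pr n true \o swindle_htpy)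
  ((compl \o swindle_pr n false) \+ (e \o swindle_pr n.+1 false))) => -[[b m] s] /=.
rewrite /swindle_htpy flin_gen ![swindle_pr _ _ (fgen _)]flin_gen /=; case: s => /=.
  by rewrite !andbF !linear0 addr0.
rewrite linearD /= swindle_pr_in !andbT; congr (_ + _).
  by case: eqP => _; rewrite ?linear0.
case: m => [|m]; rewrite ?linear0 // swindle_pr_in andbT eqSS.
by case: eqP => _; rewrite ?linear0.
Qed.

Lemma swindle_exact : exact_at swindle_diff swindle_diff.
Proof.
have split_e x : compl x + e x = x by rewrite complE subrK.
have DD x : swindle_diff (swindle_diff x) = 0.
  apply: swindle_ext => n [|]; rewrite ?swindle_diff_true linear0 //.
  case: n => [|n].
    by rewrite swindle_diff0 swindle_diff_true swindle_diff0 linearD /= qq q_compl linear0 !addr0.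
  by rewrite swindle_diffS !swindle_diff_true !linear0 addr0.
move=> x; split=> [Dx|[y <-]]; last exact: DD.
have qx0 : q (swindle_pr 0 false x) + compl (swindle_pr 0 true x) = 0.
  by rewrite -swindle_diff0 Dx linear0.
have qx : q (swindle_pr 0 false x) = 0.
  by rewrite -e_q; have /(congr1 e) := qx0; rewrite linearD /= e_compl linear0 addr0.
have eqS n : compl (swindle_pr n.+1 true x) + e (swindle_pr n true x) = 0.
  by rewrite -swindle_diffS Dx linear0.
have ey n : e (swindle_pr n true x) = 0.
  by have /(congr1 e) := eqS n; rewrite linearD /= e_compl add0r ee linear0.
have cy n : compl (swindle_pr n true x) = 0.
  case: n => [|n]; first by rewrite -[RHS]qx0 qx add0r.
  by have := eqS n; rewrite ey addr0.
have y0 n : swindle_pr n true x = 0 by rewrite -[LHS]split_e ey cy addr0.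
have [t tE] := q_exact qx.
exists (swindle_in 0 false t + swindle_htpy x); apply: swindle_ext => n [|].
  by rewrite swindle_diff_true y0.
case: n => [|n].
  rewrite swindle_diff0 !linearD /= !swindle_pr_in /= swindle_htpy_false swindle_htpy_true.
  rewrite (linear0 q) (linear0 compl) addr0 add0r linearD /= compl_compl compl_e.
  by rewrite addr0 -tE addrC split_e.
rewrite swindle_diffS !linearD /= !swindle_pr_in /= andbF !swindle_htpy_true !linear0 !add0r.
by rewrite !linearD /= compl_compl compl_e e_compl ee addr0 add0r split_e.
Qed.

Lemma swindle_diff_in x : swindle_diff (swindle_in 0 false x) = swindle_in 0 false (q x).
Proof.
apply: (@eq_on_gen _ _ _ (swindle_diff \o swindle_in 0 false) (swindle_in 0 false \o q)) => b /=.
by rewrite [swindle_in _ _ (fgen b)]flin_gen /swindle_diff flin_gen.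
Qed.

End Swindle.
Arguments swindle_in {R B}.
Arguments swindle_pr {R B}.

(** * Complexes of projective modules *)

(** The sum of all the terms of a complex of projective modules is the image of the
    idempotent [total_proj] of a free module, and [total_diff] is its differential.
    The basis consists of the elements of all the terms: every [C i] is a direct
    summand of the free module on its underlying set. *)
Section TotalComplex.
Variables (R : pzRingType) (C : int -> lmodType R).
Variable d : forall i : int, {linear C (i + 1) -> C i}.
Hypothesis C_proj : forall i, projective (C i).
Hypothesis d_exact : forall i, exact_at (d (i + 1)) (d i).

Definition total_basis : choiceType := {i : int & C i}.
Notation L := (free R total_basis).

Definition total_slot i : {linear free R (C i) -> L} :=
  flin (fun c : C i => fgen (Tagged C c)).

Lemma projective_section i : exists s : {linear C i -> free R (C i)},
  forall c, free_hull (C i) (s c) = c.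
Proof.
have [s sE] := @C_proj i _ _ (free_hull (C i)) idfun (@free_hull_surj _ _).
by exists s => c; apply: esym (sE c).
Qed.
Definition total_in i : {linear C i -> L} := total_slot i \o sval (cid (projective_section i)).
Arguments total_in : simpl never.

Definition total_coord i (x : total_basis) : C i :=
  if tag x =P i is ReflectT E then eq_rect (tag x) C (tagged x) i E else 0.
Definition total_pr i : {linear L -> C i} := flin (total_coord i).

Lemma total_coord_id i (c : C i) : total_coord i (Tagged C c) = c.
Proof.
rewrite /total_coord; case: eqP => //= E.
by rewrite (eq_axiomK E).
Qed.
Lemma total_coord_neq i (x : total_basis) : tag x != i -> total_coord i x = 0.
Proof. by rewrite /total_coord; case: eqP. Qed.

Lemma total_pr_in i (c : C i) : total_pr i (total_in i c) = c.
Proof.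
rewrite /total_in /=; case: cid => s /= sE; rewrite -[RHS]sE.
apply: (@eq_on_gen _ _ _ (total_pr i \o total_slot i) (free_hull (C i))) => c' /=.
by rewrite /total_slot flin_gen /total_pr flin_gen total_coord_id free_hull_gen.
Qed.
Lemma total_pr_in_neq i j (c : C i) : i != j -> total_pr j (total_in i c) = 0.
Proof.
move=> ij; rewrite /total_in /=; case: cid => s /= sE.
apply: (@eq_on_gen _ _ _ (total_pr j \o total_slot i) \0) => c' /=.
by rewrite /total_slot flin_gen /total_pr !flin_gen total_coord_neq.
Qed.

Definition total_proj : {linear L -> L} :=
  flin (fun x : total_basis => total_in (tag x) (tagged x)).

(** The degree [tag x] is written [tag x - 1 + 1] so that [d] applies; the transport
    that this requires is hidden in [total_coord]. *)
Definition total_diff : {linear L -> L} := flin (fun x : total_basis =>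
  total_in (tag x - 1) (d (tag x - 1) (total_coord (tag x - 1 + 1) x))).

Lemma total_pr_proj i x : total_pr i (total_proj x) = total_pr i x.
Proof.
apply: (@eq_on_gen _ _ _ (total_pr i \o total_proj) (total_pr i)) => -[j c] /=.
rewrite /total_proj flin_gen [RHS]flin_gen /=.
have [<-|ji] := eqVneq j i; first by rewrite total_pr_in total_coord_id.
by rewrite total_pr_in_neq // total_coord_neq.
Qed.

Lemma total_proj_in i (c : C i) : total_proj (total_in i c) = total_in i c.
Proof.
have H z : total_proj (total_slot i z) = total_in i (free_hull (C i) z).
  apply: (@eq_on_gen _ _ _ (total_proj \o total_slot i) (total_in i \o free_hull (C i))) => c' /=.
  by rewrite /total_slot flin_gen /total_proj flin_gen free_hull_gen.
by rewrite {1}/total_in [LHS]H; case: cid => s /= ->.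
Qed.

Lemma total_proj_idem x : total_proj (total_proj x) = total_proj x.
Proof.
apply: (@eq_on_gen _ _ _ (total_proj \o total_proj) total_proj) => b /=.
by rewrite [total_proj (fgen b)]flin_gen total_proj_in.
Qed.

Lemma total_proj_diff x : total_proj (total_diff x) = total_diff x.
Proof.
apply: (@eq_on_gen _ _ _ (total_proj \o total_diff) total_diff) => b /=.
by rewrite [total_diff (fgen b)]flin_gen total_proj_in.
Qed.

Lemma total_proj_sum (s : seq int) x : uniq s -> supported (fun b => tag b \in s) x ->
  total_proj x = \sum_(i <- s) total_in i (total_pr i x).
Proof.
move=> us; apply: (supported_ind
  (P := fun x => total_proj x = \sum_(i <- s) total_in i (total_pr i x))) => [|a [j c] y js IH].
  by rewrite linear0 big1 // => i _; rewrite (linear0 (total_pr i)) linear0.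
have lin i u v : total_in i (total_pr i (a *: u + v)) =
    a *: total_in i (total_pr i u) + total_in i (total_pr i v) by rewrite !linearP.
under [RHS]eq_bigr do rewrite lin.
rewrite big_split /= -scaler_sumr -IH linearP; congr (a *: _ + _).
rewrite (bigD1_seq j) //= [total_proj _]flin_gen /= big1 => [|i ij].
  by rewrite addr0 /total_pr flin_gen total_coord_id.
by rewrite /total_pr flin_gen total_coord_neq /= 1?eq_sym // !linear0.
Qed.

Lemma total_proj_sum_supp x :
  total_proj x = \sum_(i <- undup [seq tag b | b <- supp x]) total_in i (total_pr i x).
Proof.
apply: total_proj_sum; first exact: undup_uniq.
by move=> b bx; rewrite mem_undup map_f // mem_supp.
Qed.

Lemma total_proj_eq x y : (forall i, total_pr i x = total_pr i y) -> total_proj x = total_proj y.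
Proof.
move=> xy; apply/subr0_eq; rewrite -linearB total_proj_sum_supp big1 // => i _.
by rewrite (linearB (total_pr i)) xy subrr linear0.
Qed.

Lemma total_pr_diff i x : total_pr i (total_diff x) = d i (total_pr (i + 1) x).
Proof.
apply: (@eq_on_gen _ _ _ (total_pr i \o total_diff) (d i \o total_pr (i + 1))) => -[j c] /=.
rewrite [total_diff _]flin_gen /=.
have [->|ij] := eqVneq i (j - 1); first by rewrite total_pr_in [in RHS]flin_gen.
rewrite total_pr_in_neq 1?eq_sym // [in RHS]flin_gen total_coord_neq ?linear0 //=.
by rewrite -subr_eq eq_sym.
Qed.

Lemma total_diff_proj x : total_diff (total_proj x) = total_diff x.
Proof.
rewrite -total_proj_diff -[RHS]total_proj_diff; apply: total_proj_eq => i.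
by rewrite !total_pr_diff total_pr_proj.
Qed.

Lemma total_diff_diff x : total_diff (total_diff x) = 0.
Proof.
rewrite -total_proj_diff -[RHS](linear0 total_proj); apply: total_proj_eq => i.
rewrite !total_pr_diff linear0; apply/d_exact; by exists (total_pr (i + 1 + 1) x).
Qed.

Lemma total_diff_in i (c : C (i + 1)) : total_diff (total_in (i + 1) c) = total_in i (d i c).
Proof.
rewrite -total_proj_diff -[RHS]total_proj_in; apply: total_proj_eq => j.
rewrite total_pr_diff; have [<-|ij] := eqVneq i j; first by rewrite !total_pr_in.
by rewrite !total_pr_in_neq ?linear0 // (inj_eq (addIr 1)).
Qed.

Lemma total_diff_exact x : total_diff x = 0 -> exists y, total_proj x = total_diff y.
Proof.
move=> qx; have imq i : exists y, total_in i (total_pr i x) = total_diff y.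
  have := subrK 1 i; move: (i - 1) => k <- {i}.
  have /d_exact[c <-] : d k (total_pr (k + 1) x) = 0 by rewrite -total_pr_diff qx linear0.
  by exists (total_in (k + 1 + 1) c); rewrite total_diff_in.
have [y yE] := boolp.choice imq.
rewrite total_proj_sum_supp; exists (\sum_(i <- undup [seq tag b | b <- supp x]) y i).
by rewrite linear_sum; apply: eq_bigr => i _.
Qed.

End TotalComplex.
Arguments total_pr {R C}.

(** The differential maps the next term of the complex onto [G], and [f] is this
    surjection followed by [g]; it kills boundaries, and on the summand [G] of the
    cycles it induces [g]. *)
Lemma Gorenstein_projective_resolve (R : pzRingType) (G M : lmodType R)
    (g : {linear G -> M}) : Gorenstein_projective G ->
  exists (B : choiceType) (d : {linear free R B -> free R B})
    (f : {linear free R B -> M}) (j : {linear G -> free R B}),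
  [/\ exact_at d d, forall x, f (d x) = 0, forall x, d (j x) = 0
    & forall x, exists2 w, d w = j x & f w = g x].
Proof.
move=> [C [d [C_proj d_exact _ [i [iota [iota_inj iota_ex]]]]]].
have dd k x : d k (d (k + 1) x) = 0 by apply/d_exact; exists x.
have [b bE] : exists b : {linear C (i + 1 + 1) -> G}, forall c, iota (b c) = d (i + 1) c.
  by apply: factor_inj iota_inj _ => c; apply/iota_ex.
pose q := total_diff d C_proj.
pose e := total_proj C_proj.
have ee : forall x, e (e x) = e x by apply: total_proj_idem.
have e_q : forall x, e (q x) = q x by apply: total_proj_diff.
have qe : forall x, q (e x) = q x by apply: total_diff_proj.
have qq : forall x, q (q x) = 0 by apply: total_diff_diff.
have qex : forall x, q x = 0 -> exists y, e x = q y by apply: total_diff_exact.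
pose D := swindle_diff e q.
pose f := g \o b \o total_pr (i + 1 + 1) \o swindle_pr 0 false.
exists (swindle_basis (total_basis C)), D, f, (swindle_in 0 false \o total_in C_proj (i + 1) \o iota).
split.
- exact: swindle_exact.
- move=> x; rewrite /f /= swindle_diff0 // (linearD (total_pr _)) /=.
  have -> : total_pr (i + 1 + 1) (compl e (swindle_pr 0 true x)) = 0.
    by rewrite complE linearB /= total_pr_proj subrr.
  rewrite addr0 total_pr_diff.
  suff -> : b (d (i + 1 + 1) (total_pr (i + 1 + 1 + 1) (swindle_pr 0 false x))) = 0 by rewrite linear0.
  by apply: iota_inj; rewrite bE dd linear0.
- move=> x /=; rewrite /D swindle_diff_in /q total_diff_in //.
  have -> : d i (iota x) = 0 by apply/iota_ex; exists x.
  by rewrite !linear0.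
move=> x; have /d_exact[c cE] : d i (iota x) = 0 by apply/iota_ex; exists x.
exists (swindle_in 0 false (total_in C_proj (i + 1 + 1) c)).
  by rewrite /D swindle_diff_in /q total_diff_in //= cE.
rewrite /f /= swindle_pr_in /= total_pr_in; congr (g _); apply: iota_inj.
by rewrite bE.
Qed.

Theorem proposition3p9 (R : pzRingType)
    (hR : forall P : lmodType R, projective P -> SFI_vee P)
    (M : lmodType R) :
  has_precover (@Gorenstein_projective R) M.
Proof.
have [C [D [phi [Dex phiD univ]]]] := universal_differential M.
have DD x : D (D x) = 0 by apply/Dex; exists x.
have [p pE] := kernel_factor DD.
have p_surj : surjective p.
  move=> z; have /Dex[w wz] := incl_mem z; exists w.
  by apply: incl_inj; rewrite pE.
have [|Phi PhiE] := factor_surj (f := phi) p_surj.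
  move=> w pw; have /Dex[v <-] : D w = 0 by rewrite -pE pw linear0.
  exact: phiD.
exists (subm (ker_sub D)), Phi; split; first exact: cycles_Gorenstein_projective.
move=> G g GP; have [B [d [f [j [dex fd dj jw]]]]] := Gorenstein_projective_resolve g GP.
have [h hE] := univ B d f dex fd.
have [|eta etaE] := @kernel_factor _ _ _ D _ (h \o j).
  by move=> x; have [hd _] := hE (j x); rewrite /= -hd dj linear0.
exists eta => x /=; have [w dw fw] := jw x; have [hd hf] := hE w.
have -> : eta x = p (h w) by apply: incl_inj; rewrite etaE pE -hd /= dw.
by rewrite PhiE hf fw.
Qed.
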